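(* Let $p$ be an odd prime, $\mathbf{k}=(k_1,k_2)$ with $k_1>k_2>0$, and $a,b_1,b_2,c\in\mathbb{Z}_{>0}$. Assume $a+(k_1-1)c<p$ and that all factorials on the right-hand side below are factorials of nonnegative integers less than $p$. Then in $\mathbb{F}_p$ $$I_{0,0,0}(a,b_1,b_2,c)=(-1)^{k_1+k_2}\prod_{i=1}^{k_1-k_2}\frac{(b_1+(i-1)c)!}{(a+b_1+(i+k_1-2)c-p)!}\prod_{i=1}^{k_2}\frac{(b_2+(i-1)c)!}{(b_2+(i+k_2-k_1-2)c)!}\cdot\frac{(b_1+b_2+(i-2)c)!}{(a+b_1+b_2+(i+k_1-3)c-p)!}$$ $$\times\prod_{i=1}^{k_1}(a+(i-1)c-1)!\prod_{i=1}^{k_2}(p+(i-k_1-1)c-1)!\prod_{r=1}^2\prod_{i=1}^{k_r}\frac{(ic)!}{c!}.$$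
   Context: $\mathbb{F}_p$-integral: for a polynomial $P$ over $\mathbb{F}_p$, $\int_{[l_1,\dots,l_k]_p}P\,dx$ is the coefficient of $x_1^{l_1p-1}\cdots x_k^{l_kp-1}$. Let $t=(t_1,\dots,t_{k_1})$, $s=(s_1,\dots,s_{k_2})$, and let $[\mathbf{k}]_p$ assign $1$ to each $t_i$ and $k_1$ to each $s_j$. Master polynomial: $$\Phi_{\mathbf{k}}(t;s;a,b_1,b_2,c)=\prod_{i=1}^{k_1}t_i^a(1-t_i)^{b_1}\prod_{j=1}^{k_2}(1-s_j)^{b_2}\prod_{i,j}(s_j-t_i)^{p-c}\prod_{i<i'}(t_i-t_{i'})^{2c}\prod_{j<j'}(s_j-s_{j'})^{2c}.$$ For $f(x_1,\dots,x_k)$, $\mathrm{Sym}_xf=\frac1{k!}\sum_{\sigma\in S_k}f(x_{\sigma_1},\dots,x_{\sigma_k})$. Let $$W_{0,0,0}(t;s)=\mathrm{Sym}_t\mathrm{Sym}_s\Big(\prod_{i=1}^{k_1}(1-t_i)\prod_{j=1}^{k_2}\frac{1-s_j}{s_j-t_{j+k_1-k_2}}\Big),$$ and $$I_{0,0,0}(a,b_1,b_2,c)=\int_{[\mathbf{k}]_p}\Phi_{\mathbf{k}}(t;s;a,b_1,b_2,c)\,\frac{W_{0,0,0}(t;s)}{\prod_{i=1}^{k_1}t_i(1-t_i)\prod_{j=1}^{k_2}(1-s_j)}\,dt\,ds,$$ i.e. the coefficient of $\prod_it_i^{p-1}\prod_js_j^{k_1p-1}$ in this (polynomial) integrand reduced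 mod $p$. *)

(* Defs.v *)
From HB Require Import structures.
From mathcomp Require Import all_boot all_order all_algebra fingroup perm.
From mathcomp Require Import fraction.
From mathcomp Require Import mpoly.
Set Implicit Arguments. Unset Strict Implicit. Unset Printing Implicit Defensive.
Import Order.TTheory GRing.Theory Num.Theory.
Local Open Scope ring_scope.

(* Polynomial ring F_p[t_1..t_k1, s_1..s_k2]: variable index i < k1 is t_(i+1),
   variable index k1 + j (j < k2) is s_(j+1). *)
Definition PR (p k1 k2 : nat) := {mpoly 'F_p[k1 + k2]}.
Definition FR (p k1 k2 : nat) := {fraction (PR p k1 k2)}.

Section Integrand.
Variables (p k1 k2 : nat).
Local Notation R := (PR p k1 k2).
Local Notation K := (FR p k1 k2).

Definition tvar (i : 'I_k1) : K := FracField.tofrac ('X_(lshift k2 i) : R).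
Definition svar (j : 'I_k2) : K := FracField.tofrac ('X_(rshift k1 j) : R).

(* extend a function on 'I_k to nat (junk value 0 outside the range) *)
Definition onat (k : nat) (f : 'I_k -> K) (n : nat) : K :=
  if @insub nat (fun m => m < k)%N 'I_k n is Some o then f o else 0.

Definition Phi (a b1 b2 c : nat) (t : 'I_k1 -> K) (s : 'I_k2 -> K) : K :=
  (\prod_(i < k1) (t i ^+ a * (1 - t i) ^+ b1))
  * (\prod_(j < k2) (1 - s j) ^+ b2)
  * (\prod_(i < k1) \prod_(j < k2) (s j - t i) ^+ (p - c))
  * (\prod_(i < k1) \prod_(i' < k1 | (i < i')%N) (t i - t i') ^+ (2 * c))
  * (\prod_(j < k2) \prod_(j' < k2 | (j < j')%N) (s j - s j') ^+ (2 * c)).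

(* the function inside Sym_t Sym_s in W_{0,0,0}; 0-based: the 1-based index
   j+k1-k2 becomes j+(k1-k2) for j < k2 *)
Definition Wterm (t : 'I_k1 -> K) (s : 'I_k2 -> K) : K :=
  (\prod_(i < k1) (1 - t i))
  * \prod_(j < k2) ((1 - s j) / (s j - onat t (j + (k1 - k2))%N)).

Definition W000 : K :=
  ((k1`!)%:R * (k2`!)%:R)^-1 *
  \sum_(sg : 'S_k1) \sum_(tau : 'S_k2)
     Wterm (fun i => tvar (sg i)) (fun j => svar (tau j)).

Definition integrand000 (a b1 b2 c : nat) : K :=
  Phi a b1 b2 c tvar svar * W000 /
  ((\prod_(i < k1) (tvar i * (1 - tvar i))) * \prod_(j < k2) (1 - svar j)).

Definition mono000 : 'X_{1..k1 + k2} :=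
  [multinom (if (i < k1)%N then (p - 1)%N else (k1 * p - 1)%N) | i < k1 + k2].

Definition Fp_integral_is (F : K) (v : 'F_p) : Prop :=
  exists P : R, FracField.tofrac P = F /\ P@_mono000 = v.

End Integrand.

(* factorial of an integer z (meaningful for 0 <= z), viewed in F_p *)
Definition fctF (p : nat) (z : int) : 'F_p := ((`|z|%N)`!)%:R.

Definition fct_ok (p : nat) (z : int) : bool := (0 <= z) && (z < p%:Z).

(* Main.v *)
(** Both the master polynomial and the coefficient are symmetric in the t's and in
    the s's, so W_{0,0,0} may be replaced by the single product of the
    1 / (s_j - t_{j+k1-k2}).  Coefficients of t^(p-1) and s^(k1 p-1) of partial
    derivatives vanish modulo p.  Write F_n for the density (with t_i^a instead of
    t_i^(a-1)) times that product times 1 / (t_1 ... t_n).  For an unpaired variable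
    (n < k1 - k2) the vector field (1 - t_{n+1}) d/dt_{n+1}, and for a paired one the
    field (1 - t) d/dt + (1 - s) d/ds in both variables of the pair, gives a linear
    relation; after symmetrizing each interaction term over the exchange of the two
    variables (pairs) involved, only F_n and F_{n+1} survive, in the spirit of Aomoto.
    Since F_{k1} at a+1 is F_0 at a, this is a first-order recursion in a.  It is
    started at a + (k1-1) c = p, where the t-degree is the least possible and the
    coefficient splits into a Dyson constant term in t times a Morris constant term in
    s.  Morris' is the case k2 = 0 of the recursion, and Dyson's for n+1 variables is
    Morris' for n variables after setting the last variable to 1. *)
Require Import Defs.
From HB Require Import structures.
From mathcomp Require Import all_boot all_order all_algebra fingroup perm.
From mathcomp Require Import generic_quotient fraction.
From mathcomp Require Import mpoly ring zify.
From Stdlib Require Import ClassicalEpsilon.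
Set Implicit Arguments. Unset Strict Implicit. Unset Printing Implicit Defensive.
Import Order.TTheory GRing.Theory Num.Theory.
Local Open Scope ring_scope.

(** The weight 1 / (s_j - t_{j+k1-k2}) makes every object a rational function, whereas the
    coefficient functional only makes sense on polynomials. Additivity may therefore be used only
    after each summand of a logarithmic derivative, multiplied by F_n, is known to be polynomial;
    this shapes the way the terms are grouped. Under differentiation the exponent p - c acts as -c,
    so the s-t interaction has the sign opposite to that of the t-t and s-s interactions. The factor
    1 - t of the vector field turns (1 - t)^b1 into the scalar -b1, without a pole. A pair has to
    move as a whole: the joint field sends s - t to -(s - t), so no pole at s = t arises, as it
    would if only one of the two moved. Symmetrizing requires halving, hence p odd. The recursion
    relates a to a + 1 and is followed upwards, from the given a to the larger value p - (k1-1) c;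
    the ranges of the factorials serve to divide by the factors met on the way. *)

Local Notation "x %:F" := (FracField.tofrac x).

(** * Logarithmic derivatives *)

(** Spreads a single factor over a whole product as an indicator exponent, so that a quotient of
    products can be examined factor by factor. *)
Lemma prod_pred1 (K : fieldType) (I : finType) (i0 : I) (y : I -> K) :
  \prod_i y i ^+ (i == i0) = y i0.
Proof.
by rewrite (bigD1 i0) //= eqxx expr1 big1 ?mulr1 // => i /negbTE ->; rewrite expr0.
Qed.

Section LogDerivative.
Variables (K : fieldType) (dd : K -> K).
Hypothesis ddD : {morph dd : x y / x + y}.
Hypothesis ddM : forall x y, dd (x * y) = dd x * y + x * dd y.

Definition dlog x := dd x / x.

Lemma dd0 : dd 0 = 0.
Proof. by apply: (addrI (dd 0)); rewrite -ddD !addr0. Qed.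

Lemma dd1 : dd 1 = 0.
Proof. by apply: (addrI (dd 1)); rewrite addr0 -{3}[1]mulr1 ddM mulr1 mul1r. Qed.

Lemma ddN x : dd (- x) = - dd x.
Proof. by apply: (addrI (dd x)); rewrite -ddD !subrr dd0. Qed.

Lemma ddB : {morph dd : x y / x - y}.
Proof. by move=> x y; rewrite ddD ddN. Qed.

Lemma ddE x : x != 0 -> dd x = x * dlog x.
Proof. by move=> x0; rewrite /dlog mulrC divfK. Qed.

Lemma dlog1 : dlog 1 = 0.
Proof. by rewrite /dlog dd1 mul0r. Qed.

Lemma dlogM x y : x != 0 -> y != 0 -> dlog (x * y) = dlog x + dlog y.
Proof. by move=> x0 y0; rewrite /dlog ddM; field; rewrite x0 y0. Qed.

Lemma dlogV x : x != 0 -> dlog x^-1 = - dlog x.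
Proof.
move=> x0; have xV0 : x^-1 != 0 by rewrite invr_eq0.
by apply: (addrI (dlog x)); rewrite -dlogM // divff // dlog1 subrr.
Qed.

Lemma dlogX x n : x != 0 -> dlog (x ^+ n) = n%:R * dlog x.
Proof.
move=> x0; elim: n => [|n IHn]; first by rewrite dlog1 mul0r.
by rewrite exprS dlogM ?expf_neq0 // IHn -[n.+1]addn1 natrD; ring.
Qed.

Lemma dlog_prod (I : finType) (P : pred I) (y : I -> K) :
  (forall i, P i -> y i != 0) ->
  dlog (\prod_(i | P i) y i) = \sum_(i | P i) dlog (y i).
Proof.
move=> y0; pose Q x z := x != 0 /\ dlog x = z.
suff [] : Q (\prod_(i | P i) y i) (\sum_(i | P i) dlog (y i)) by [].
apply: (big_rec2 Q) => [|i z x Pi [x0 <-]].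
  by split; rewrite ?oner_eq0 ?dlog1.
by split; rewrite ?mulf_neq0 ?dlogM ?y0.
Qed.

End LogDerivative.

Section Kronecker.
Variables (K : fieldType).

Lemma sum_pred1l (I : finType) (x : I) (y : I -> K) :
  \sum_i (i == x)%:R * y i = y x.
Proof.
by rewrite (bigD1 x) //= eqxx mul1r big1 ?addr0 // => i /negbTE ->; rewrite mul0r.
Qed.

(** Only the variable [x] moves, with speed [u]. The ordered pairs [(x, i)] and [(i, x)] contribute
    the same quotient, hence the factor 2. *)
Lemma sum_pairs_pred1 (I : finType) (x : I) (u : K) (y : I -> K) :
  injective y ->
  \sum_i \sum_(i' | i' != i) ((i == x)%:R * u - (i' == x)%:R * u) / (y i - y i')
    = 2%:R * \sum_(i | i != x) u / (y x - y i).
Proof.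
move=> injy; rewrite (bigD1 x) //= [RHS]mulr_natl mulr2n; congr (_ + _).
  by apply: eq_bigr => i /negbTE ->; rewrite eqxx mul1r mul0r subr0.
apply: eq_bigr => i nix; have xni : x != i by rewrite eq_sym.
rewrite (bigD1 x xni) /= big1 ?addr0 => [|j /andP[_ /negbTE->]].
  by rewrite eqxx (negbTE nix) mul1r mul0r sub0r -(opprB (y x)) invrN mulrNN.
by rewrite (negbTE nix) !mul0r subrr mul0r.
Qed.

End Kronecker.

(** * The Selberg density *)

(* The product runs over ordered pairs: it is [Delta ^ (2c)] up to sign, and is
   visibly symmetric. *)
Definition vanderm (R : comNzRingType) (I : finType) (c : nat) (y : I -> R) :=
  \prod_i \prod_(i' | i' != i) (y i - y i') ^+ c.

Lemma rmorph_vanderm (R R' : comNzRingType) (f : {rmorphism R -> R'}) (I : finType)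
  (c : nat) (y : I -> R) : f (vanderm c y) = vanderm c (f \o y).
Proof.
rewrite /vanderm rmorph_prod; apply: eq_bigr => i _; rewrite rmorph_prod.
by apply: eq_bigr => j _; rewrite rmorphXn rmorphB.
Qed.

Section SelbergDensity.
Variables (K : fieldType) (d k : nat) (t : 'I_(d + k) -> K) (s : 'I_k -> K).

(* [m] stands for [p - c], so that [m%:R = - c%:R]. *)
Definition density (a b1 b2 m c : nat) :=
  (\prod_i t i ^+ a) * (\prod_i (1 - t i) ^+ b1) * (\prod_j (1 - s j) ^+ b2)
  * (\prod_i \prod_j (s j - t i) ^+ m) * vanderm c t * vanderm c s.

Definition invt (n : nat) := \prod_(i < d + k | (i < n)%N) (t i)^-1.
(** Writing [k1 = d + k] makes the partner of [s j] simply [t (rshift d j)]; the first [d] variables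
    [t] are the unpaired ones. *)
Definition invst := \prod_j (s j - t (rshift d j))^-1.

(** The F_n of the overview. At [n = d + k] it is the integrand of the theorem up to sign, before
    symmetrization. *)
Definition weighted a b1 b2 m c n := density a b1 b2 m c * (invt n * invst).

Lemma invstE : invst = \prod_i \prod_j (s j - t i) ^- (i == rshift d j).
Proof.
rewrite exchange_big /=; apply: eq_bigr => j _.
rewrite -(prod_pred1 (rshift d j) (fun i => (s j - t i)^-1)).
by apply: eq_bigr => i _; rewrite exprVn.
Qed.

(** All denominators are absorbed by exponents: [a] drops by one everywhere, [m] only at the paired
    factors. The homogeneous factor in [t] alone is set apart because it will carry the whole
    [t]-degree at the initial value. *)
Lemma weighted_full a b1 b2 m c :
  (forall i, t i != 0) -> (forall i j, s j - t i != 0) -> (0 < a)%N -> (0 < m)%N ->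
  weighted a b1 b2 m c (d + k) =
  (\prod_i t i ^+ a.-1 * vanderm c t)
  * ((\prod_i (1 - t i) ^+ b1) * (\prod_j (1 - s j) ^+ b2)
     * (\prod_i \prod_j (s j - t i) ^+ (m - (i == rshift d j))) * vanderm c s).
Proof.
move=> t0 st0 a_gt0 m_gt0.
have <- : (\prod_i t i ^+ a) * invt (d + k) = \prod_i t i ^+ a.-1.
  rewrite /invt [X in _ * X]big_mkcond -big_split /=; apply: eq_bigr => i _.
  by rewrite ltn_ord -{1}(prednK a_gt0) exprSr mulfK.
have <- : (\prod_i \prod_j (s j - t i) ^+ m) * invst =
    \prod_i \prod_j (s j - t i) ^+ (m - (i == rshift d j)).
  rewrite invstE -big_split /=; apply: eq_bigr => i _; rewrite -big_split /=.
  by apply: eq_bigr => j _; rewrite expfB_cond // (negbTE (st0 _ _)); case: eqP.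
by rewrite /weighted /density; ring.
Qed.

End SelbergDensity.

(** * Stokes relations and symmetrization *)

(* [I] is the image of the polynomials in their fraction field [K], and [E] the
   coefficient functional. *)
Section Calculus.
Variables (K V : fieldType) (I : K -> Prop) (E : K -> V).
Hypotheses (I1 : I 1) (IB : forall x y, I x -> I y -> I (x - y))
  (IM : forall x y, I x -> I y -> I (x * y))
  (EB : forall x y, I x -> I y -> E (x - y) = E x - E y).
Variables (d k : nat) (t : 'I_(d + k) -> K) (s : 'I_k -> K).
Hypotheses (It : forall i, I (t i)) (Is : forall j, I (s j)).
Hypotheses (t_inj : injective t) (s_inj : injective s)
  (st0 : forall i j, s j - t i != 0) (t0 : forall i, t i != 0)
  (t1 : forall i, 1 - t i != 0) (s1 : forall j, 1 - s j != 0).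
Variables (a b1 b2 m c : nat).
Hypotheses (a_gt0 : (0 < a)%N) (m_gt0 : (0 < m)%N) (c_gt0 : (0 < c)%N).
Hypothesis mNc : m%:R = - c%:R :> K.
Hypothesis V2 : 2%:R != 0 :> V.

(** * Closure of the polynomials, and additivity of the functional on them *)

Lemma closed0 : I 0. Proof. by rewrite -(subrr 1); apply: IB. Qed.
Lemma closedN x : I x -> I (- x). Proof. by rewrite -sub0r; apply: IB; apply: closed0. Qed.
Lemma closedD x y : I x -> I y -> I (x + y).
Proof. by move=> Ix Iy; rewrite -[y]opprK; apply/IB/closedN. Qed.
Lemma closed_prod (J : finType) (P : pred J) (y : J -> K) :
  (forall i, P i -> I (y i)) -> I (\prod_(i | P i) y i).
Proof. by move=> Iy; apply: (big_ind I) => //; apply: IM. Qed.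
Lemma closed_sum (J : finType) (P : pred J) (y : J -> K) :
  (forall i, P i -> I (y i)) -> I (\sum_(i | P i) y i).
Proof. by move=> Iy; apply: (big_ind I) => //; [apply: closed0 | apply: closedD]. Qed.
Lemma closedX x n : I x -> I (x ^+ n).
Proof. by move=> Ix; elim: n => [|n IHn]; rewrite ?expr0 // exprS; apply: IM. Qed.
Lemma closed_nat n : I n%:R.
Proof. by elim: n => [|n IHn]; [apply: closed0 | rewrite -addn1 natrD; apply: closedD]. Qed.
Lemma closed_expB x n j : I x -> x != 0 -> (j <= n)%N -> I (x ^+ n * x ^- j).
Proof. by move=> Ix x0 jn; rewrite -expfB_cond ?(negbTE x0) //; apply: closedX. Qed.

Lemma functional0 : E 0 = 0. Proof. by rewrite -(subrr 1) EB // subrr. Qed.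
Lemma functionalN x : I x -> E (- x) = - E x.
Proof. by move=> Ix; rewrite -sub0r EB ?functional0 ?sub0r //; apply: closed0. Qed.
Lemma functionalD x y : I x -> I y -> E (x + y) = E x + E y.
Proof.
by move=> Ix Iy; rewrite -{1}[y]opprK EB ?functionalN ?opprK //; apply: closedN.
Qed.
Lemma functional_nat n x : I x -> E (n%:R * x) = n%:R * E x.
Proof.
move=> Ix; elim: n => [|n IHn]; first by rewrite !mul0r functional0.
rewrite -addn1 !natrD !mulrDl functionalD ?IHn ?mul1r //; apply: IM => //; exact: closed_nat.
Qed.
Lemma functional_sum (J : finType) (P : pred J) (y : J -> K) :
  (forall i, P i -> I (y i)) -> E (\sum_(i | P i) y i) = \sum_(i | P i) E (y i).
Proof.
move=> Iy; pose Q x z := I x /\ E x = z.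
suff [] : Q (\sum_(i | P i) y i) (\sum_(i | P i) E (y i)) by [].
apply: (big_rec2 Q) => [|i z x Pi [Ix <-]]; first by split; rewrite ?functional0 //; apply: closed0.
by split; [apply: closedD | rewrite functionalD]; rewrite ?Iy //; apply: Iy.
Qed.

Lemma tB0 i i' : i != i' -> t i - t i' != 0.
Proof. by move=> ii'; rewrite subr_eq0 (inj_eq t_inj). Qed.
Lemma sB0 i i' : i != i' -> s i - s i' != 0.
Proof. by move=> ii'; rewrite subr_eq0 (inj_eq s_inj). Qed.

Local Notation F := (weighted t s a b1 b2 m c).
Local Notation Phi := (density t s a b1 b2 m c).

Lemma I_ta n : I ((\prod_i t i ^+ a) * invt t n).
Proof.
rewrite /invt [X in _ * X]big_mkcond -big_split /=; apply: closed_prod => i _.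
case: ifP => _; last by rewrite mulr1; apply: closedX.
by rewrite -{2}[t i]expr1; apply: closed_expB.
Qed.

Lemma I_st : I ((\prod_i \prod_j (s j - t i) ^+ m) * invst t s).
Proof.
rewrite invstE -big_split /=; apply: closed_prod => i _; rewrite -big_split /=.
apply: closed_prod => j _; apply: closed_expB => //; first exact: IB.
by case: eqP.
Qed.

(** [invst] takes one unit of the exponent [m > 0] at paired factors only, so one more pole is
    allowed at an unpaired factor. *)
Lemma I_st_div i0 j0 : i0 != rshift d j0 ->
  I ((\prod_i \prod_j (s j - t i) ^+ m) * invst t s / (s j0 - t i0)).
Proof.
move=> ij0; rewrite invstE.
rewrite -(prod_pred1 i0 (fun i => (s j0 - t i)^-1)) -!big_split /=.
apply: closed_prod => i _.
rewrite -(prod_pred1 j0 (fun j => ((s j - t i)^-1) ^+ (i == i0))) -!big_split /=.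
apply: closed_prod => j _.
(* The two indicators are never both 1, by the hypothesis on [i0] and [j0]; at most one unit is
   taken from [m]. *)
rewrite -exprM exprVn -mulrA -invfM -exprD; apply: closed_expB => //; first exact: IB.
case: (i =P i0) => [->|_]; last by rewrite mul0n addn0; case: eqP.
case: (j =P j0) => [->|_]; last by rewrite muln0 addn0; case: eqP.
by rewrite (negbTE ij0).
Qed.

Lemma I_vanderm (J : finType) (y : J -> K) : (forall i, I (y i)) -> I (vanderm c y).
Proof. by move=> Iy; apply: closed_prod => i _; apply: closed_prod => j _; apply/closedX/IB. Qed.

Lemma I_vanderm_div (J : finType) (y : J -> K) i0 j0 : injective y ->
  (forall i, I (y i)) -> i0 != j0 -> I (vanderm c y / (y i0 - y j0)).
Proof.
move=> y_inj Iy ij0; rewrite /vanderm (bigD1 i0) //= (bigD1 j0) 1?eq_sym //=.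
have yB : y i0 - y j0 != 0 by rewrite subr_eq0 (inj_eq y_inj).
rewrite mulrC !mulrA; apply: IM; last first.
  by apply: closed_prod => i _; apply: closed_prod => j _; apply/closedX/IB.
apply: IM; last by apply: closed_prod => j _; apply/closedX/IB.
by rewrite mulrC -{2}[_ - _]expr1; apply: closed_expB => //; apply: IB.
Qed.

Lemma I_one_subr (J : finType) (y : J -> K) b :
  (forall i, I (y i)) -> I (\prod_i (1 - y i) ^+ b).
Proof. by move=> Iy; apply: closed_prod => i _; apply/closedX/IB. Qed.

Lemma I_weighted n : I (F n).
Proof.
suff -> : F n = ((\prod_i t i ^+ a) * invt t n) * (\prod_i (1 - t i) ^+ b1)
  * (\prod_j (1 - s j) ^+ b2) * ((\prod_i \prod_j (s j - t i) ^+ m) * invst t s)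
  * vanderm c t * vanderm c s.
  do 2!apply: (IM _ (I_vanderm _)) => //; apply: (IM _ I_st).
  by do 2!apply: (IM _ (I_one_subr _ _)) => //; apply: I_ta.
by rewrite /weighted /density; ring.
Qed.

Lemma I_weighted_st n i j : i != rshift d j -> I (F n / (s j - t i)).
Proof.
move=> ij.
suff -> : F n / (s j - t i) =
  ((\prod_i t i ^+ a) * invt t n) * (\prod_i (1 - t i) ^+ b1)
  * (\prod_j (1 - s j) ^+ b2)
  * ((\prod_i \prod_j (s j - t i) ^+ m) * invst t s / (s j - t i))
  * vanderm c t * vanderm c s.
  do 2!apply: (IM _ (I_vanderm _)) => //; apply: (IM _ (I_st_div _)) => //.
  by do 2!apply: (IM _ (I_one_subr _ _)) => //; apply: I_ta.
by rewrite /weighted /density; ring.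
Qed.

Lemma I_weighted_tt n i i' : i != i' -> I (F n / (t i - t i')).
Proof.
move=> ii'.
suff -> : F n / (t i - t i') =
  ((\prod_i t i ^+ a) * invt t n) * (\prod_i (1 - t i) ^+ b1)
  * (\prod_j (1 - s j) ^+ b2)
  * ((\prod_i \prod_j (s j - t i) ^+ m) * invst t s)
  * (vanderm c t / (t i - t i')) * vanderm c s.
  apply: (IM _ (I_vanderm _)) => //; apply: (IM _ (I_vanderm_div _ _ _)) => //.
  apply: (IM _ I_st).
  by do 2!apply: (IM _ (I_one_subr _ _)) => //; apply: I_ta.
by rewrite /weighted /density; ring.
Qed.

Lemma I_weighted_ss n j j' : j != j' -> I (F n / (s j - s j')).
Proof.
move=> jj'.
suff -> : F n / (s j - s j') =
  ((\prod_i t i ^+ a) * invt t n) * (\prod_i (1 - t i) ^+ b1)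
  * (\prod_j (1 - s j) ^+ b2)
  * ((\prod_i \prod_j (s j - t i) ^+ m) * invst t s)
  * vanderm c t * (vanderm c s / (s j - s j')).
  apply: (IM _ (I_vanderm_div _ _ _)) => //; apply: (IM _ (I_vanderm _)) => //.
  apply: (IM _ I_st).
  by do 2!apply: (IM _ (I_one_subr _ _)) => //; apply: I_ta.
by rewrite /weighted /density; ring.
Qed.

(** * Exchanges of variables and their effect on the weight *)

Section Symmetry.
Variable S : 'S_(d + k) -> 'S_k -> {rmorphism K -> K}.
Hypotheses (St : forall sg ta i, S sg ta (t i) = t (sg i))
  (Ss : forall sg ta j, S sg ta (s j) = s (ta j))
  (IS : forall sg ta x, I x -> I (S sg ta x))
  (ES : forall sg ta x, I x -> E (S sg ta x) = E x).

Lemma S_vanderm (J : finType) (y : J -> K) (f : {rmorphism K -> K}) (p : {perm J}) :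
  (forall i, f (y i) = y (p i)) -> f (vanderm c y) = vanderm c y.
Proof.
move=> fy; rewrite /vanderm rmorph_prod [RHS](reindex_perm p) /=.
apply: eq_bigr => i _; rewrite rmorph_prod [RHS](reindex_perm p) /=.
apply: eq_big => [j|j _]; first by rewrite (inj_eq perm_inj).
by rewrite rmorphXn rmorphB !fy.
Qed.

Lemma S_density sg ta : S sg ta Phi = Phi.
Proof.
rewrite /density !rmorphM /=.
rewrite (S_vanderm (p := sg)) // (S_vanderm (p := ta)) // !rmorph_prod /=.
do ![congr (_ * _)].
- rewrite [RHS](reindex_perm sg) /=; apply: eq_bigr => i _.
  by rewrite rmorphXn St.
- rewrite [RHS](reindex_perm sg) /=; apply: eq_bigr => i _.
  by rewrite rmorphXn rmorphB rmorph1 St.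
- rewrite [RHS](reindex_perm ta) /=; apply: eq_bigr => i _.
  by rewrite rmorphXn rmorphB rmorph1 Ss.
rewrite [RHS](reindex_perm sg) /=; apply: eq_bigr => i _.
rewrite rmorph_prod [RHS](reindex_perm ta) /=; apply: eq_bigr => j _.
by rewrite rmorphXn rmorphB Ss St.
Qed.


Lemma S_invt_ge (n : nat) (x i : 'I_(d + k)) ta : (n <= x)%N -> (n <= i)%N ->
  S (tperm x i) ta (invt t n) = invt t n.
Proof.
move=> nx ni; rewrite /invt rmorph_prod; apply: eq_bigr => l ln.
rewrite fmorphV St tpermD //; apply: contraTneq ln => <-; by rewrite -leqNgt.
Qed.

Lemma S_invt_lt (n : nat) (x i : 'I_(d + k)) ta : (n <= x)%N -> (i < n)%N ->
  S (tperm x i) ta (invt t n) = invt t n * (t i / t x).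
Proof.
move=> nx ni; rewrite /invt (bigD1 i) //= rmorphM fmorphV /= St tpermR.
rewrite rmorph_prod mulrAC mulrA mulVf // mul1r; congr (_ * _).
apply: eq_bigr => l /andP[ln li]; rewrite fmorphV /= St tpermD // 1?eq_sym //.
by apply: contraTneq ln => ->; rewrite -leqNgt.
Qed.

Lemma S_invst_lshift (x i : 'I_d) :
  S (tperm (lshift k x) (lshift k i)) 1 (invst t s) = invst t s.
Proof.
rewrite /invst rmorph_prod; apply: eq_bigr => j _.
rewrite fmorphV rmorphB /= St Ss perm1 tpermD //; by rewrite eq_lrshift.
Qed.

Lemma S_invst_mixed (x : 'I_d) (j : 'I_k) :
  S (tperm (lshift k x) (rshift d j)) 1 (invst t s)
    = invst t s * ((s j - t (rshift d j)) / (s j - t (lshift k x))).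
Proof.
rewrite /invst (bigD1 j) //= rmorphM fmorphV rmorphB /= St Ss perm1 tpermR.
rewrite rmorph_prod mulrAC mulrA mulVf // mul1r; congr (_ * _).
apply: eq_bigr => l lj; rewrite fmorphV rmorphB /= St Ss perm1 tpermD //.
  by rewrite eq_lrshift.
by rewrite (inj_eq (@rshift_inj d k)) eq_sym.
Qed.

Lemma S_invst_joint (i j : 'I_k) :
  S (tperm (rshift d i) (rshift d j)) (tperm i j) (invst t s) = invst t s.
Proof.
rewrite /invst rmorph_prod [RHS](reindex_perm (tperm i j)) /=.
apply: eq_bigr => l _; rewrite fmorphV rmorphB /= St Ss.
by rewrite -(inj_tperm _ _ _ (@rshift_inj d k)).
Qed.

(** Exchanging only the t's of two pairs re-pairs them crosswise. Exchanging only the s's has the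
    same effect, hence the same ratio in [S_invst_s]. *)
Lemma S_invst_t (i j : 'I_k) : i != j ->
  S (tperm (rshift d i) (rshift d j)) 1 (invst t s) = invst t s *
    ((s i - t (rshift d i)) * (s j - t (rshift d j))
     / ((s i - t (rshift d j)) * (s j - t (rshift d i)))).
Proof.
move=> ij; have ji : j != i by rewrite eq_sym.
rewrite /invst (bigD1 i) //= (bigD1 j) //= !rmorphM !fmorphV !rmorphB /=.
rewrite !St !Ss !perm1 tpermL tpermR rmorph_prod.
set A := \prod_(_ | _) _; set B := \prod_(_ | _) _.
have -> : A = B; last by field; rewrite !st0.
apply: eq_bigr => l /andP[li lj]; rewrite fmorphV rmorphB /= St Ss perm1.
by rewrite tpermD // (inj_eq (@rshift_inj d k)) eq_sym.
Qed.

Lemma S_invst_s (i j : 'I_k) : i != j ->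
  S 1 (tperm i j) (invst t s) = invst t s *
    ((s i - t (rshift d i)) * (s j - t (rshift d j))
     / ((s i - t (rshift d j)) * (s j - t (rshift d i)))).
Proof.
move=> ij; have ji : j != i by rewrite eq_sym.
rewrite /invst (bigD1 i) //= (bigD1 j) //= !rmorphM !fmorphV !rmorphB /=.
rewrite !St !Ss !perm1 tpermL tpermR rmorph_prod.
set A := \prod_(_ | _) _; set B := \prod_(_ | _) _.
have -> : A = B; last by field; rewrite !st0.
apply: eq_bigr => l /andP[li lj]; rewrite fmorphV rmorphB /= St Ss perm1.
by rewrite tpermD // eq_sym.
Qed.

Lemma S_weighted n sg ta r :
  S sg ta (invt t n) * S sg ta (invst t s) = invt t n * invst t s * r ->
  S sg ta (F n) = F n * r.
Proof. by move=> Sr; rewrite /weighted rmorphM S_density rmorphM Sr mulrA. Qed.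

Lemma weightedS (x : 'I_(d + k)) (n : nat) : x = n :> nat -> F n.+1 = F n / t x.
Proof.
move=> xn; rewrite /weighted /invt (bigD1 x) /= ?xn //.
rewrite (eq_bigl (fun i : 'I__ => (i < n)%N)) => [|i]; first by ring.
by rewrite ltnS -val_eqE /= xn ltn_neqAle andbC.
Qed.

(* [E] ignores exchanges of variables, hence only depends on symmetrizations; [r] is
   the factor by which the exchange multiplies the weight. *)
Lemma E_swap n sg ta r g h : I (F n * g) -> I (F n * h) ->
  S sg ta (F n) = F n * r -> g + r * S sg ta g = h + r * S sg ta h ->
  E (F n * g) = E (F n * h).
Proof.
move=> Ig Ih Fr gh; apply: (mulfI V2); have D2 (z : V) : 2%:R * z = z + z by ring.
rewrite !D2 -{2}(ES sg ta Ig) -{2}(ES sg ta Ih) -!functionalD //; try exact: IS.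
by rewrite (rmorphM _ (F n) g) (rmorphM _ (F n) h) Fr -!mulrA -!mulrDr gh.
Qed.

(** Averaging over four elements, meant for two pairs whose t's and s's are exchanged independently.
    The joint exchange alone does not suffice in [E_paired_lt]: the unequal weights of the two t's
    leave a pole at [s x0 = s j], which the exchange of the s's removes. *)
Lemma E_swap3 n sg1 ta1 sg2 ta2 sg3 ta3 r1 r2 r3 g h : I (F n * g) -> I (F n * h) ->
  S sg1 ta1 (F n) = F n * r1 -> S sg2 ta2 (F n) = F n * r2 ->
  S sg3 ta3 (F n) = F n * r3 ->
  g + r1 * S sg1 ta1 g + r2 * S sg2 ta2 g + r3 * S sg3 ta3 g
    = h + r1 * S sg1 ta1 h + r2 * S sg2 ta2 h + r3 * S sg3 ta3 h ->
  E (F n * g) = E (F n * h).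
Proof.
move=> Ig Ih Fr1 Fr2 Fr3 gh; apply/(mulfI V2)/(mulfI V2).
have E4 y : I (F n * y) -> 2%:R * (2%:R * E (F n * y)) =
    E (F n * (y + r1 * S sg1 ta1 y + r2 * S sg2 ta2 y + r3 * S sg3 ta3 y)).
  move=> Iy; have Sy sg ta r : S sg ta (F n) = F n * r ->
      I (F n * (r * S sg ta y)) /\ E (F n * (r * S sg ta y)) = E (F n * y).
    by rewrite mulrA => <-; rewrite -(rmorphM _ (F n)); split; [apply: IS | apply: ES].
  have [[Iy1 E1] [Iy2 E2]] := (Sy _ _ _ Fr1, Sy _ _ _ Fr2).
  have [Iy3 E3] := Sy _ _ _ Fr3.
  by rewrite !mulrDr !functionalD ?E1 ?E2 ?E3 //; [ring | ..]; do ?[apply: closedD].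
by rewrite !E4 // gh.
Qed.

Lemma I_mul_div z n w : I z -> I (F n / w) -> I (F n * (z / w)).
Proof. by move=> Iz IF; rewrite mulrCA; apply: IM. Qed.

Lemma I_t1 i : I (1 - t i). Proof. exact: IB. Qed.
Lemma I_s1 j : I (1 - s j). Proof. exact: IB. Qed.

Lemma I_weighted_lin (x : 'I_(d + k)) n y : x = n :> nat ->
  I (F n * ((t x)^-1 - y%:R)).
Proof.
move=> xn; rewrite mulrBr -(weightedS xn); apply: IB; first exact: I_weighted.
by apply: IM; [apply: I_weighted | apply: closed_nat].
Qed.

(** The form in which the interaction lemmas reach their right-hand side: the term is compared,
    after symmetrization, with [(t x)^-1 - y]. *)
Lemma E_weighted_lin (x : 'I_(d + k)) n y : x = n :> nat ->
  E (F n * ((t x)^-1 - y%:R)) = E (F n.+1) - y%:R * E (F n).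
Proof.
have IF := I_weighted n; have IF' := I_weighted n.+1.
move=> xn; rewrite mulrBr -(weightedS xn) [_ * y%:R]mulrC EB ?functional_nat //.
by apply: IM => //; apply: closed_nat.
Qed.

Lemma I_weighted_nat n y : I (F n * y%:R).
Proof. by apply: IM; [apply: I_weighted | apply: closed_nat]. Qed.

Lemma E_weightedN n y : E (F n * - y%:R) = - (y%:R * E (F n)).
Proof.
rewrite mulrN functionalN ?[_ * y%:R]mulrC ?functional_nat //; first exact: I_weighted.
by rewrite mulrC; apply: I_weighted_nat.
Qed.

(* Interaction of the Euler field of variable number [n] with each other variable:
   the terms of [dlog] attached to that variable, grouped so that their symmetrization
   is a combination of [F n.+1] and [F n] alone. *)
Section Unpaired.
Variables (n : nat) (x0 : 'I_d).
Hypothesis xn : x0 = n :> nat.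
Local Notation x := (lshift k x0).

Lemma E_unpaired_lt (i : 'I_d) : (i < n)%N ->
  E (F n * (2%:R * (1 - t x) / (t x - t (lshift k i)))) = E (F n.+1) - 2%:R * E (F n).
Proof.
move=> ilt; have xi : x != lshift k i by rewrite -val_eqE /= xn neq_ltn ilt orbT.
rewrite -(@E_weighted_lin x) //.
apply: (@E_swap _ (tperm x (lshift k i)) 1 (t (lshift k i) / t x)).
- by apply: I_mul_div (I_weighted_tt n xi); apply: IM (I_t1 _); apply: closed_nat.
- exact: I_weighted_lin.
- apply: S_weighted; rewrite S_invst_lshift S_invt_lt //= ?xn //; ring.
rewrite rmorphB fmorph_div rmorphM !rmorphB fmorphV /= !rmorph_nat rmorph1 !St tpermL tpermR.
have xi0 := tB0 xi; have ix0 : t (lshift k i) - t x != 0 by rewrite -opprB oppr_eq0.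
by field; rewrite !t0 xi0 ix0.
Qed.

Lemma E_unpaired_gt (i : 'I_d) : (n < i)%N ->
  E (F n * (2%:R * (1 - t x) / (t x - t (lshift k i)))) = - (1%:R * E (F n)).
Proof.
move=> ilt; have xi : x != lshift k i by rewrite -val_eqE /= xn neq_ltn ilt.
rewrite -E_weightedN.
apply: (@E_swap _ (tperm x (lshift k i)) 1 1).
- by apply: I_mul_div (I_weighted_tt n xi); apply: IM (I_t1 _); apply: closed_nat.
- by rewrite mulrN; apply/closedN/I_weighted_nat.
- by apply: S_weighted; rewrite S_invst_lshift S_invt_ge ?mulr1 //= ?xn // ltnW.
rewrite rmorphN fmorph_div rmorphM !rmorphB /= !rmorph_nat rmorph1 !St tpermL tpermR.
have xi0 := tB0 xi; have ix0 : t (lshift k i) - t x != 0 by rewrite -opprB oppr_eq0.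
by field; rewrite xi0 ix0.
Qed.

(** The exchange makes [x] the partner of [s j]. Neither of the two terms symmetrizes to a multiple
    of the weight by itself; their sum does. *)
Lemma E_unpaired_paired (j : 'I_k) :
  E (F n * (2%:R * (1 - t x) / (t x - t (rshift d j)) + (1 - t x) / (s j - t x)))
   = - (1%:R * E (F n)).
Proof.
have xj : x != rshift d j by rewrite eq_lrshift.
rewrite -E_weightedN.
apply: (@E_swap _ (tperm x (rshift d j)) 1
   ((s j - t (rshift d j)) / (s j - t (lshift k x0)))).
- rewrite mulrDr; apply: closedD.
    by apply: I_mul_div (I_weighted_tt n xj); apply: IM (I_t1 _); apply: closed_nat.
  by apply: I_mul_div (I_t1 _) (I_weighted_st n xj).
- by rewrite mulrN; apply/closedN/I_weighted_nat.
- apply: S_weighted; rewrite S_invst_mixed S_invt_ge ?mulrA //= ?xn //.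
  by apply: leq_trans (leq_addr _ _); rewrite -xn ltnW.
rewrite rmorphD !fmorph_div !rmorphM !rmorphB /= !rmorph_nat rmorph1 rmorphN rmorph1.
rewrite !St !Ss perm1 tpermL tpermR.
have xi0 := tB0 xj; have ix0 : t (rshift d j) - t x != 0 by rewrite -opprB oppr_eq0.
by field; rewrite xi0 ix0 !st0.
Qed.

End Unpaired.

(** * Interactions of a pair with unpaired variables and with other pairs *)

Section Paired.
Variables (n : nat) (x0 : 'I_k).
Hypothesis xn : (d + x0)%N = n :> nat.
Local Notation x := (rshift d x0).
Local Notation pairing i := (2%:R * (1 - t x) / (t x - t i) - (1 - s x0) / (s x0 - t i)).

Lemma I_pairing i : x != i -> I (F n * pairing i).
Proof.
move=> xi; rewrite mulrBr; apply: IB.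
  by apply: I_mul_div (I_weighted_tt n xi); apply: IM (I_t1 _); apply: closed_nat.
by apply: I_mul_div (I_s1 _) (I_weighted_st n _); rewrite eq_sym.
Qed.

Lemma E_paired_unpaired (i : 'I_d) :
  E (F n * pairing (lshift k i)) = E (F n.+1) - 1%:R * E (F n).
Proof.
have ix : lshift k i != x by rewrite eq_lrshift.
have xi : x != lshift k i by rewrite eq_sym.
rewrite -(@E_weighted_lin x) //.
apply: (@E_swap _ (tperm (lshift k i) x) 1
  ((t (lshift k i) / t x) * ((s x0 - t x) / (s x0 - t (lshift k i))))).
- exact: I_pairing.
- exact: I_weighted_lin.
- apply: S_weighted; rewrite S_invst_mixed tpermC S_invt_lt //= -?xn ?leqnn //.
    by ring.
  by apply: leq_trans (leq_addr _ _).
rewrite !rmorphB fmorphV !fmorph_div !rmorphM !rmorphB /= !rmorph_nat rmorph1.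
rewrite !St !Ss perm1 tpermL tpermR.
have xi0 := tB0 xi; have ix0 := tB0 ix.
by field; rewrite xi0 ix0 !st0 !t0.
Qed.

Local Notation pairing2 j := (pairing (rshift d j)
  + (2%:R * (1 - s x0) / (s x0 - s j) + (1 - t x) / (s j - t x))).

Lemma I_pairing2 j : x0 != j -> I (F n * pairing2 j).
Proof.
move=> xj; have xj' : x != rshift d j by rewrite (inj_eq (@rshift_inj d k)).
rewrite mulrDr; apply: closedD; first exact: I_pairing.
rewrite mulrDr; apply: closedD.
  by apply: I_mul_div (I_weighted_ss n xj); apply: IM (I_s1 _); apply: closed_nat.
by apply: I_mul_div (I_t1 _) (I_weighted_st n _).
Qed.

Lemma E_paired_gt (j : 'I_k) : (x0 < j)%N ->
  E (F n * pairing2 j) = - (1%:R * E (F n)).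
Proof.
move=> xltj; have xj : x0 != j by rewrite -val_eqE /= neq_ltn xltj.
have xj' : x != rshift d j by rewrite (inj_eq (@rshift_inj d k)).
have jx' : rshift d j != x by rewrite eq_sym.
have jx : j != x0 by rewrite eq_sym.
rewrite -E_weightedN.
apply: (@E_swap _ (tperm x (rshift d j)) (tperm x0 j) 1).
- exact: I_pairing2.
- by rewrite mulrN; apply/closedN/I_weighted_nat.
- apply: S_weighted; rewrite S_invst_joint S_invt_ge ?mulr1 //= -?xn ?leqnn //.
  by rewrite leq_add2l ltnW.
rewrite !rmorphD !rmorphN !fmorph_div !rmorphM !rmorphB /= !rmorph_nat rmorph1.
rewrite !St !Ss !tpermL !tpermR.
have := (tB0 xj', tB0 jx', sB0 xj, sB0 jx) => -[[[h1 h2] h3] h4].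
by field; rewrite h1 h2 h3 h4 !st0.
Qed.

Lemma E_paired_lt (j : 'I_k) : (j < x0)%N ->
  E (F n * pairing2 j) = E (F n.+1) - 2%:R * E (F n).
Proof.
move=> jltx; have xj : x0 != j by rewrite -val_eqE /= neq_ltn jltx orbT.
have xj' : x != rshift d j by rewrite (inj_eq (@rshift_inj d k)).
have jx' : rshift d j != x by rewrite eq_sym.
have jx : j != x0 by rewrite eq_sym.
rewrite -(@E_weighted_lin x) //.
have jn : (rshift d j < n)%N by rewrite /= -xn ltn_add2l.
have nx : (n <= x)%N by rewrite /= -xn.
pose r := (s x0 - t x) * (s j - t (rshift d j))
     / ((s x0 - t (rshift d j)) * (s j - t x)).
have S1t q : S 1 q (invt t n) = invt t n.
  by rewrite -(tperm1 x) S_invt_ge // -xn leqnn.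
(* In this order: both exchanged, t's only, s's only. [invt] sees only the t's, so the last factor
   is [r] without [t (rshift d j) / t x]. *)
apply: (@E_swap3 _ (tperm x (rshift d j)) (tperm x0 j) (tperm x (rshift d j)) 1
  1 (tperm x0 j) (t (rshift d j) / t x) (t (rshift d j) / t x * r) r).
- exact: I_pairing2.
- exact: I_weighted_lin.
- by apply: S_weighted; rewrite S_invst_joint S_invt_lt //; ring.
- by apply: S_weighted; rewrite S_invst_t // S_invt_lt // /r; ring.
- by apply: S_weighted; rewrite S_invst_s // S1t /r; ring.
rewrite !rmorphD !rmorphN !fmorphV !fmorph_div !rmorphM !rmorphB /= !rmorph_nat rmorph1.
rewrite !St !Ss !perm1 !tpermL !tpermR /r.
have := (tB0 xj', tB0 jx', sB0 xj, sB0 jx) => -[[[h1 h2] h3] h4].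
by field; rewrite h1 h2 h3 h4 !st0 !t0.
Qed.

End Paired.

Definition partial_derivation (D : K -> K) :=
  [/\ {morph D : x y / x + y}, forall x y, D (x * y) = D x * y + x * D y,
      forall x, I x -> I (D x) & forall x, I x -> E (D x) = 0].

Lemma weighted_neq0 n : F n != 0.
Proof.
have P0 (J : finType) (P : pred J) (y : J -> K) :
    (forall i, P i -> y i != 0) -> \prod_(i | P i) y i != 0.
  by move=> y0; apply/prodf_neq0.
rewrite /weighted /density /vanderm /invt /invst !mulf_neq0 // ?P0 // => i _;
  rewrite ?invr_eq0 ?expf_neq0 ?P0 // => j ji; rewrite expf_neq0 //.
- by apply: tB0; rewrite eq_sym.
- by apply: sB0; rewrite eq_sym.
Qed.

(** * Logarithmic derivative of the weighted density along a general field *)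

Section LogDensity.
Variables (D : K -> K) (al : 'I_(d + k) -> K) (be : 'I_k -> K).
Hypotheses (DD : {morph D : x y / x + y})
  (DM : forall x y, D (x * y) = D x * y + x * D y)
  (Dt : forall i, D (t i) = al i) (Ds : forall j, D (s j) = be j).

Lemma dlog_vanderm (J : finType) (y z : J -> K) : injective y ->
  (forall i, D (y i) = z i) -> dlog D (vanderm c y) =
    c%:R * \sum_i \sum_(i' | i' != i) (z i - z i') / (y i - y i').
Proof.
move=> y_inj Dy; have y0 i j : j != i -> y i - y j != 0.
  by move=> ji; rewrite subr_eq0 (inj_eq y_inj) eq_sym.
rewrite /vanderm dlog_prod // => [|i _]; last first.
  by apply/prodf_neq0 => j ji; rewrite expf_neq0 ?y0.
rewrite mulr_sumr; apply: eq_bigr => i _; rewrite dlog_prod // => [|j ji]; last first.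
  by rewrite expf_neq0 ?y0.
rewrite mulr_sumr; apply: eq_bigr => j ji.
by rewrite dlogX ?y0 // /dlog (ddB DD) !Dy.
Qed.

Lemma dlog_weighted n : dlog D (F n) =
  a%:R * (\sum_i al i / t i) - b1%:R * (\sum_i al i / (1 - t i))
  - b2%:R * (\sum_j be j / (1 - s j))
  - c%:R * (\sum_i \sum_j (be j - al i) / (s j - t i))
  + c%:R * (\sum_i \sum_(i' | i' != i) (al i - al i') / (t i - t i'))
  + c%:R * (\sum_j \sum_(j' | j' != j) (be j - be j') / (s j - s j'))
  - \sum_(i < d + k | (i < n)%N) al i / t i
  - \sum_j (be j - al (rshift d j)) / (s j - t (rshift d j)).
Proof.
have P0 (J : finType) (P : pred J) (y : J -> K) :
    (forall i, P i -> y i != 0) -> \prod_(i | P i) y i != 0.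
  by move=> y0; apply/prodf_neq0.
have := weighted_neq0 n.
rewrite /weighted /density !mulf_eq0 !negb_or.
case/andP => /andP[] /andP[] /andP[] /andP[] /andP[h1 h2] h3 h4 h5 h6 /andP[h7 h8].
rewrite !dlogM ?mulf_neq0 // (dlog_vanderm t_inj Dt) (dlog_vanderm s_inj Ds).
have dN (x : K) y : (1 - x != 0) -> D x = y -> dlog D (1 - x) = - (y / (1 - x)).
  by move=> _ <-; rewrite /dlog ddB // dd1 // sub0r mulNr.
have e1 : dlog D (\prod_i t i ^+ a) = a%:R * (\sum_i al i / t i).
  rewrite dlog_prod // => [|i _]; last by rewrite expf_neq0.
  by rewrite mulr_sumr; apply: eq_bigr => i _; rewrite dlogX // /dlog Dt.
have e2 : dlog D (\prod_i (1 - t i) ^+ b1) = - (b1%:R * (\sum_i al i / (1 - t i))).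
  rewrite dlog_prod // => [|i _]; last by rewrite expf_neq0.
  rewrite mulr_sumr -sumrN; apply: eq_bigr => i _.
  by rewrite dlogX // (dN _ (al i)) // mulrN.
have e3 : dlog D (\prod_i (1 - s i) ^+ b2) = - (b2%:R * (\sum_j be j / (1 - s j))).
  rewrite dlog_prod // => [|i _]; last by rewrite expf_neq0.
  rewrite mulr_sumr -sumrN; apply: eq_bigr => i _.
  by rewrite dlogX // (dN _ (be i)) // mulrN.
have e4 : dlog D (\prod_i \prod_j (s j - t i) ^+ m) =
    - (c%:R * (\sum_i \sum_j (be j - al i) / (s j - t i))).
  rewrite dlog_prod // => [|i _]; last by apply: P0 => j _; rewrite expf_neq0.
  rewrite mulr_sumr -sumrN; apply: eq_bigr => i _.
  rewrite dlog_prod // => [|j _]; last by rewrite expf_neq0.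
  rewrite mulr_sumr -sumrN; apply: eq_bigr => j _.
  by rewrite dlogX // mNc mulNr /dlog ddB // Ds Dt.
have e5 : dlog D (invt t n) = - (\sum_(i < d + k | (i < n)%N) al i / t i).
  rewrite dlog_prod // => [|i _]; last by rewrite invr_eq0.
  by rewrite -sumrN; apply: eq_bigr => i _; rewrite dlogV // /dlog Dt.
have e6 : dlog D (invst t s) =
    - (\sum_j (be j - al (rshift d j)) / (s j - t (rshift d j))).
  rewrite dlog_prod // => [|i _]; last by rewrite invr_eq0.
  by rewrite -sumrN; apply: eq_bigr => i _; rewrite dlogV // /dlog ddB // Ds Dt.
by rewrite e1 e2 e3 e4 e5 e6 !addrA.
Qed.

End LogDensity.

Lemma sum_lt_gt (R : fieldType) (N : nat) (x0 : 'I_N) (X Y : R) (f : 'I_N -> R) :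
  (forall i : 'I_N, (i < x0)%N -> f i = X) -> (forall i : 'I_N, (x0 < i)%N -> f i = Y) ->
  \sum_(i | i != x0) f i = x0%:R * X + (N%:R - 1 - x0%:R) * Y.
Proof.
move=> fX fY; pose g (i : 'I_N) := if (i < x0)%N then X - Y else 0.
have -> : \sum_(i | i != x0) f i = \sum_(i | i != x0) (g i + Y).
  apply: eq_bigr => i ix; rewrite /g; case: ltngtP => [/fX ->|/fY ->|/val_inj ixE].
  - by rewrite subrK.
  - by rewrite add0r.
  - by rewrite ixE eqxx in ix.
have eg : \sum_(i | i != x0) g i = x0%:R * (X - Y).
  have -> : \sum_(i | i != x0) g i = \sum_i g i.
    by rewrite [RHS](bigD1 x0) //= /g ltnn add0r.
  rewrite -big_mkcond /= (big_ord_narrow (ltnW (ltn_ord x0))) sumr_const card_ord.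
  by rewrite mulr_natl.
have eY : \sum_(i < N | i != x0) Y = N%:R * Y - Y.
  have : \sum_(i < N) Y = Y + \sum_(i < N | i != x0) Y by rewrite (bigD1 x0).
  by rewrite sumr_const card_ord [RHS]addrC => YN; rewrite mulr_natl YN addrK.
by rewrite big_split /= eg eY; ring.
Qed.

Section Steps.
Variables (pt : 'I_(d + k) -> K -> K) (ps : 'I_k -> K -> K).
Hypotheses (ptP : forall i, partial_derivation (pt i))
  (psP : forall j, partial_derivation (ps j))
  (ptt : forall i i', pt i (t i') = (i' == i)%:R) (pts : forall i j, pt i (s j) = 0)
  (pst : forall i j, ps j (t i) = 0) (pss : forall j j', ps j (s j') = (j' == j)%:R).

(** Stokes applied to [(1 - t x) * y]: differentiating the factor gives back [y]. *)
Lemma E_euler_t x y : I y -> E ((1 - t x) * pt x y) = E y.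
Proof.
have [DD DM ID' ED'] := ptP x => Iy.
have := ED' _ (IM (I_t1 x) Iy); rewrite DM ddB // dd1 // ptt eqxx sub0r mulN1r.
rewrite functionalD ?functionalN //; last first.
- by apply: IM (I_t1 x) (ID' _ Iy).
- exact: closedN.
by move/eqP; rewrite addrC subr_eq0 => /eqP.
Qed.

Lemma E_euler_s x y : I y -> E ((1 - s x) * ps x y) = E y.
Proof.
have [DD DM ID' ED'] := psP x => Iy.
have := ED' _ (IM (I_s1 x) Iy); rewrite DM ddB // dd1 // pss eqxx sub0r mulN1r.
rewrite functionalD ?functionalN //; last first.
- by apply: IM (I_s1 x) (ID' _ Iy).
- exact: closedN.
by move/eqP; rewrite addrC subr_eq0 => /eqP.
Qed.

Lemma step_unpaired (x0 : 'I_d) (n : nat) : x0 = n :> nat ->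
  (a%:R + n%:R * c%:R) * E (F n.+1) =
  (a%:R + 1 + b1%:R + ((d + k)%:R - 1 + n%:R) * c%:R) * E (F n).
Proof.
move=> xn; set x := lshift k x0; have [DD DM _ _] := ptP x.
pose D y := (1 - t x) * pt x y.
have D_D : {morph D : y z / y + z} by move=> y z; rewrite /D DD mulrDr.
have D_M y z : D (y * z) = D y * z + y * D z by rewrite /D DM; ring.
have Dt i : D (t i) = (i == x)%:R * (1 - t x) by rewrite /D ptt mulrC.
have Ds i : D (s i) = 0 by rewrite /D pts mulr0.
have Fn0 := weighted_neq0 n; have IF := I_weighted n.
pose A (i : 'I_d) := 2%:R * (1 - t x) / (t x - t (lshift k i)).
pose B j := 2%:R * (1 - t x) / (t x - t (rshift d j)) + (1 - t x) / (s j - t x).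
have IA i : i != x0 -> I (F n * A i).
  move=> ix; apply: I_mul_div; first by apply: IM (I_t1 _); apply: closed_nat.
  by apply: I_weighted_tt; rewrite (inj_eq (@lshift_inj d k)) eq_sym.
have IB' j : I (F n * B j).
  rewrite mulrDr; apply: closedD; apply: I_mul_div.
  - by apply: IM (I_t1 _); apply: closed_nat.
  - by apply: I_weighted_tt; rewrite eq_lrshift.
  - exact: I_t1.
  - by apply: I_weighted_st; rewrite eq_lrshift.
have : E (F n) = E (F n * (a%:R * ((t x)^-1 - 1%:R)) + F n * - b1%:R
    + c%:R * (\sum_(i | i != x0) F n * A i + \sum_j F n * B j)).
  rewrite -(E_euler_t x IF) -/(D (F n)) (ddE D Fn0).
  rewrite (dlog_weighted D_D D_M Dt Ds); congr E.
  have e1 (g : 'I_(d + k) -> K) :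
      \sum_i ((i == x)%:R * (1 - t x)) / g i = (1 - t x) / g x.
    rewrite -[RHS](sum_pred1l x (fun i => (1 - t x) / g i)).
    by apply: eq_bigr => i _; rewrite mulrA.
  have e4 : \sum_i \sum_j (0 - (i == x)%:R * (1 - t x)) / (s j - t i) =
      - \sum_j (1 - t x) / (s j - t x).
    rewrite exchange_big -sumrN; apply: eq_bigr => j _.
    rewrite -(e1 (fun i => s j - t i)) -sumrN.
    by apply: eq_bigr => i _; rewrite sub0r mulNr.
  have e7 : \sum_(i < d + k | (i < n)%N) (i == x)%:R * (1 - t x) / t i = 0.
    rewrite big1 // => i iltn; have /negbTE -> : i != x by rewrite -val_eqE /= xn neq_ltn iltn.
    by rewrite !mul0r.
  have e8 : \sum_j (0 - (rshift d j == x)%:R * (1 - t x)) / (s j - t (rshift d j)) = 0.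
    by rewrite big1 // => j _; rewrite eq_rlshift mul0r subrr mul0r.
  have e6 : \sum_(j : 'I_k) \sum_(j' | j' != j) (0 - 0) / (s j - s j') = 0.
    by rewrite big1 // => j _; rewrite big1 // => j' _; rewrite subrr mul0r.
  have e3 : \sum_j 0 / (1 - s j) = 0 by rewrite big1 // => j _; rewrite mul0r.
  rewrite (e1 t) (e1 (fun i => 1 - t i)) sum_pairs_pred1 // e3 e4 e6 e7 e8.
  have -> : \sum_(i | i != x) (1 - t x) / (t x - t i) =
      \sum_(i | i != x0) (1 - t x) / (t x - t (lshift k i))
      + \sum_j (1 - t x) / (t x - t (rshift d j)).
    rewrite big_split_ord; congr (_ + _); apply: eq_bigl => i.
    by rewrite /= /x eq_rlshift.
  have -> : \sum_(i | i != x0) F n * A i =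
      F n * (2%:R * \sum_(i | i != x0) (1 - t x) / (t x - t (lshift k i))).
    rewrite mulr_sumr mulr_sumr; apply: eq_bigr => i _; rewrite /A; ring.
  have -> : \sum_j F n * B j = F n * (2%:R * (\sum_j (1 - t x) / (t x - t (rshift d j)))
      + \sum_j (1 - t x) / (s j - t x)).
    by rewrite mulr_sumr -big_split mulr_sumr; apply: eq_bigr => i _; rewrite /= /B; ring.
  set S1 := \sum_(i | i != x0) _.
  set S2 := \sum_j (1 - t x) / (t x - t (rshift d j)).
  set S3 := \sum_j (1 - t x) / (s j - t x).
  by move: (t0 x) (t1 x) => ? ?; field; apply/andP.
have Il : I (F n * ((t x)^-1 - 1%:R)) by apply: I_weighted_lin.
have Ia : I (F n * (a%:R * ((t x)^-1 - 1%:R))).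
  by rewrite mulrCA; apply: IM Il; apply: closed_nat.
have Ib : I (F n * - b1%:R) by rewrite mulrN; apply/closedN/I_weighted_nat.
have IsA := closed_sum IA; have IsB : I (\sum_j F n * B j) by apply: closed_sum.
have Ic : I (c%:R * (\sum_(i | i != x0) F n * A i + \sum_j F n * B j)).
  by apply: IM (closedD IsA IsB); apply: closed_nat.
rewrite (functionalD (closedD Ia Ib) Ic) (functionalD Ia Ib) mulrCA.
rewrite (functional_nat _ Il) (functional_nat _ (closedD IsA IsB)).
rewrite E_weighted_lin // E_weightedN (functionalD IsA IsB) !functional_sum //.
rewrite (sum_lt_gt (X := E (F n.+1) - 2%:R * E (F n)) (Y := - (1%:R * E (F n)))); last first.
- by move=> i; rewrite xn; apply: E_unpaired_gt.
- by move=> i; rewrite xn; apply: E_unpaired_lt.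
under eq_bigr => j _ do rewrite (E_unpaired_paired xn).
rewrite sumr_const card_ord -[_ *+ k]mulr_natl xn natrD => /esym/eqP.
rewrite -subr_eq0 => /eqP EF; apply/eqP; rewrite -subr_eq0; apply/eqP.
by apply: (etrans _ EF); ring.
Qed.

Lemma step_paired (x0 : 'I_k) (n : nat) : (d + x0)%N = n :> nat ->
  (a%:R + n%:R * c%:R) * E (F n.+1) =
  (a%:R + 1 + b1%:R + b2%:R + ((d + k)%:R - 2%:R + x0%:R) * c%:R) * E (F n).
Proof.
move=> xn; set x := rshift d x0.
have [DD DM ID1 _] := ptP x; have [DD' DM' ID2 _] := psP x0.
pose D y := (1 - t x) * pt x y + (1 - s x0) * ps x0 y.
have D_D : {morph D : y z / y + z} by move=> y z; rewrite /D DD DD'; ring.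
have D_M y z : D (y * z) = D y * z + y * D z by rewrite /D DM DM'; ring.
have Dt i : D (t i) = (i == x)%:R * (1 - t x) by rewrite /D ptt pst; ring.
have Ds i : D (s i) = (i == x0)%:R * (1 - s x0) by rewrite /D pts pss; ring.
have Fn0 := weighted_neq0 n; have IF := I_weighted n.
pose A i := 2%:R * (1 - t x) / (t x - t (lshift k i))
  - (1 - s x0) / (s x0 - t (lshift k i)).
pose B j := 2%:R * (1 - t x) / (t x - t (rshift d j))
  - (1 - s x0) / (s x0 - t (rshift d j))
  + (2%:R * (1 - s x0) / (s x0 - s j) + (1 - t x) / (s j - t x)).
have IA i : I (F n * A i) by apply: I_pairing; rewrite eq_rlshift.
have IB' j : j != x0 -> I (F n * B j) by rewrite eq_sym => jx; apply: I_pairing2.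
(* The 2 counts the Stokes relations of the two variables of the pair. The pair's own factor
   [s x0 - t x] has exponent [m - 1], that is -(c + 1), and its logarithmic derivative is -1, whence
   [c.+1]. *)
have : 2%:R * E (F n) = E (F n * (a%:R * ((t x)^-1 - 1%:R)) + F n * c.+1%:R
    + F n * - (b1 + b2)%:R
    + c%:R * (\sum_i F n * A i + \sum_(j | j != x0) F n * B j)).
  transitivity (E (D (F n))).
    rewrite /D functionalD ?E_euler_t ?E_euler_s //; first by ring.
      by apply: IM (I_t1 _) (ID1 _ IF).
    by apply: IM (I_s1 _) (ID2 _ IF).
  rewrite (ddE D Fn0).
  rewrite (dlog_weighted D_D D_M Dt Ds); congr E.
  have e1 (g : 'I_(d + k) -> K) :
      \sum_i ((i == x)%:R * (1 - t x)) / g i = (1 - t x) / g x.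
    rewrite -[RHS](sum_pred1l x (fun i => (1 - t x) / g i)).
    by apply: eq_bigr => i _; rewrite mulrA.
  have e1' (g : 'I_k -> K) :
      \sum_i ((i == x0)%:R * (1 - s x0)) / g i = (1 - s x0) / g x0.
    rewrite -[RHS](sum_pred1l x0 (fun i => (1 - s x0) / g i)).
    by apply: eq_bigr => i _; rewrite mulrA.
  have e4 : \sum_i \sum_j ((j == x0)%:R * (1 - s x0) - (i == x)%:R * (1 - t x)) / (s j - t i) =
      \sum_i (1 - s x0) / (s x0 - t i) - \sum_j (1 - t x) / (s j - t x).
    under eq_bigr => i _ do under eq_bigr => j _ do rewrite mulrBl.
    under eq_bigr => i _ do rewrite sumrB (e1' (fun j => s j - t i)).
    rewrite sumrB; congr (_ - _); rewrite exchange_big; apply: eq_bigr => j _.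
    by rewrite (e1 (fun i => s j - t i)).
  have e7 : \sum_(i < d + k | (i < n)%N) (i == x)%:R * (1 - t x) / t i = 0.
    rewrite big1 // => i iltn.
    have /negbTE -> : i != x by rewrite -val_eqE /= xn neq_ltn iltn.
    by rewrite !mul0r.
  (* Moving both variables gives the numerator [(1 - s x0) - (1 - t x)], which cancels the
     denominator up to sign. *)
  have e8 : \sum_j ((j == x0)%:R * (1 - s x0) - (rshift d j == x)%:R * (1 - t x))
      / (s j - t (rshift d j)) = - 1.
    transitivity (((1 - s x0) - (1 - t x)) / (s x0 - t x)); last first.
      by field; rewrite st0.
    rewrite -[RHS](sum_pred1l x0
      (fun j => ((1 - s x0) - (1 - t x)) / (s j - t (rshift d j)))).
    apply: eq_bigr => j _; rewrite /x (inj_eq (@rshift_inj d k)).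
    by rewrite -mulrBr mulrA.
  rewrite (e1 t) (e1 (fun i => 1 - t i)) (e1' (fun j => 1 - s j)).
  rewrite !sum_pairs_pred1 // e4 e7 e8.
  have e9 (g : 'I_(d + k) -> K) : \sum_(i | i != x) g i =
      \sum_i g (lshift k i) + \sum_(j | j != x0) g (rshift d j).
    rewrite big_split_ord; congr (_ + _); apply: eq_bigl => i.
      by rewrite /= /x eq_lrshift.
    by rewrite /= /x (inj_eq (@rshift_inj d k)).
  have -> : \sum_i (1 - s x0) / (s x0 - t i) = (1 - s x0) / (s x0 - t x)
      + \sum_(i | i != x) (1 - s x0) / (s x0 - t i) by rewrite (bigD1 x).
  have -> : \sum_j (1 - t x) / (s j - t x) = (1 - t x) / (s x0 - t x)
      + \sum_(j | j != x0) (1 - t x) / (s j - t x) by rewrite (bigD1 x0).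
  rewrite !e9.
  have -> : \sum_i F n * A i =
      F n * (2%:R * (\sum_i (1 - t x) / (t x - t (lshift k i)))
             - \sum_i (1 - s x0) / (s x0 - t (lshift k i))).
    rewrite mulr_sumr -sumrB mulr_sumr; apply: eq_bigr => i _; rewrite /A; ring.
  have -> : \sum_(j | j != x0) F n * B j =
      F n * ((2%:R * (\sum_(j | j != x0) (1 - t x) / (t x - t (rshift d j)))
             - \sum_(j | j != x0) (1 - s x0) / (s x0 - t (rshift d j)))
       + (2%:R * (\sum_(j | j != x0) (1 - s x0) / (s x0 - s j))
          + \sum_(j | j != x0) (1 - t x) / (s j - t x))).
    rewrite !mulr_sumr -sumrB -!big_split mulr_sumr.
    by apply: eq_bigr => i _; rewrite /= /B; ring.
  move: (\sum_i (1 - t x) / (t x - t (lshift k i))) => S1.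
  move: (\sum_i (1 - s x0) / (s x0 - t (lshift k i))) => S2.
  move: (\sum_(j | j != x0) (1 - t x) / (t x - t (rshift d j))) => S3.
  move: (\sum_(j | j != x0) (1 - s x0) / (s x0 - t (rshift d j))) => S4.
  move: (\sum_(j | j != x0) (1 - s x0) / (s x0 - s j)) => S5.
  move: (\sum_(j | j != x0) (1 - t x) / (s j - t x)) => S6.
  move: (t0 x) (t1 x) (s1 x0) (st0 x x0) => h1 h2 h3 h4.
  by rewrite -[c.+1]addn1 !natrD; field; rewrite h1 h2 h3 h4.
have Il : I (F n * ((t x)^-1 - 1%:R)) by apply: I_weighted_lin.
have Ia : I (F n * (a%:R * ((t x)^-1 - 1%:R))).
  by rewrite mulrCA; apply: IM Il; apply: closed_nat.
have Ib : I (F n * - (b1 + b2)%:R) by rewrite mulrN; apply/closedN/I_weighted_nat.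
have Ib' := I_weighted_nat n c.+1.
have IsB := closed_sum IB'; have IsA : I (\sum_j F n * A j) by apply: closed_sum.
have Ic : I (c%:R * (\sum_i F n * A i + \sum_(j | j != x0) F n * B j)).
  by apply: IM (closedD IsA IsB); apply: closed_nat.
rewrite (functionalD (closedD (closedD Ia Ib') Ib) Ic).
rewrite (functionalD (closedD Ia Ib') Ib) (functionalD Ia Ib') mulrCA.
rewrite (functional_nat _ Il).
rewrite (functional_nat _ (closedD IsA IsB)) [F n * c.+1%:R]mulrC (functional_nat _ IF).
rewrite E_weighted_lin // E_weightedN (functionalD IsA IsB) !functional_sum //.
rewrite (sum_lt_gt (X := E (F n.+1) - 2%:R * E (F n)) (Y := - (1%:R * E (F n)))); last first.
- by move=> i; apply: E_paired_gt.
- by move=> i; apply: E_paired_lt.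
under eq_bigr => j _ do rewrite (E_paired_unpaired xn).
rewrite sumr_const card_ord -[_ *+ d]mulr_natl -xn -[c.+1]addn1 !natrD => /esym/eqP.
rewrite -subr_eq0 => /eqP EF; apply/eqP; rewrite -subr_eq0; apply/eqP.
by apply: (etrans _ EF); ring.
Qed.

(** The factors [a + n * c] stay on the left: nothing in this abstract setting makes them
    nonzero. *)
Lemma weighted_recursion :
  (\prod_(n < d + k) (a%:R + n%:R * c%:R)) * E (F (d + k)%N) =
  (\prod_(n < d) (a%:R + 1 + b1%:R + ((d + k)%:R - 1 + n%:R) * c%:R))
  * (\prod_(j < k) (a%:R + 1 + b1%:R + b2%:R + ((d + k)%:R - 2%:R + j%:R) * c%:R))
  * E (F 0).
Proof.
have H1 (n : nat) : (n <= d)%N -> (\prod_(i < n) (a%:R + i%:R * c%:R)) * E (F n) =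
    (\prod_(i < n) (a%:R + 1 + b1%:R + ((d + k)%:R - 1 + i%:R) * c%:R)) * E (F 0).
  elim: n => [|n IHn] nd; first by rewrite !big_ord0.
  rewrite !big_ord_recr /= -mulrA (@step_unpaired (Ordinal nd)) // mulrCA IHn ?(ltnW nd) //.
  by rewrite mulrCA mulrA.
have H2 (n : nat) : (n <= k)%N ->
    (\prod_(i < d + n) (a%:R + i%:R * c%:R)) * E (F (d + n)%N) =
    (\prod_(i < d) (a%:R + 1 + b1%:R + ((d + k)%:R - 1 + i%:R) * c%:R))
    * (\prod_(j < n) (a%:R + 1 + b1%:R + b2%:R + ((d + k)%:R - 2%:R + j%:R) * c%:R))
    * E (F 0).
  elim: n => [|n IHn] nk; first by rewrite addn0 big_ord0 mulr1 H1.
  rewrite addnS !big_ord_recr /= -mulrA (@step_paired (Ordinal nk)) // mulrCA IHn ?(ltnW nk) //.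
  by rewrite mulrCA !mulrA.
exact: H2.
Qed.

End Steps.
End Symmetry.
End Calculus.

(** * Morphisms and derivations of fraction fields *)

Section FractionLifts.
Variable R : idomainType.

Definition fnum (x : {fraction R}) : R := (frac (repr x)).1.
Definition fden (x : {fraction R}) : R := (frac (repr x)).2.

Lemma fden_neq0 x : fden x != 0. Proof. exact: denom_ratioP. Qed.

Lemma tofrac_neq0 (y : R) : y != 0 -> y%:F != 0.
Proof. by rewrite tofrac_eq0. Qed.

Lemma fnum_fden x : x = (fnum x)%:F / (fden x)%:F.
Proof.
apply: (canRL (mulfK (tofrac_neq0 (fden_neq0 x)))).
rewrite /fnum /fden -[x in LHS]reprK; set y := repr x.
unlock FracField.tofrac; rewrite -[LHS]FracField.pi_mul; apply/eqmodP => /=.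
rewrite FracField.equivfE /FracField.mulf !numden_Ratio ?oner_neq0 ?mulf_neq0
  ?denom_ratioP ?oner_neq0 //.
by rewrite !mulr1 /y reprK mulrC.
Qed.

Lemma frac_eq (n e n' e' : R) : e != 0 -> e' != 0 ->
  n%:F / e%:F = n'%:F / e'%:F -> n * e' = n' * e.
Proof.
move=> e0 e0' /eqP; rewrite eqr_div ?tofrac_neq0 // -!rmorphM tofrac_eq.
by move/eqP.
Qed.

Lemma frac_congr (n e n' e' : R) : e != 0 -> e' != 0 ->
  n * e' = n' * e -> n%:F / e%:F = n'%:F / e'%:F.
Proof.
by move=> e0 e0' ne; apply/eqP; rewrite eqr_div ?tofrac_neq0 // -!tofracM ne.
Qed.

Lemma fracD (n e n' e' : R) : e != 0 -> e' != 0 ->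
  n%:F / e%:F + n'%:F / e'%:F = (n * e' + n' * e)%:F / (e * e')%:F.
Proof. by move=> e0 e0'; rewrite addf_div ?tofrac_neq0 // !tofracM tofracD !tofracM. Qed.

Lemma fracN (n e : R) : - (n%:F / e%:F) = (- n)%:F / e%:F.
Proof. by rewrite tofracN mulNr. Qed.

Lemma fracM (n e n' e' : R) :
  n%:F / e%:F * (n'%:F / e'%:F) = (n * n')%:F / (e * e')%:F.
Proof. by rewrite mulf_div !tofracM. Qed.

Lemma frac_ind2 (P : {fraction R} -> {fraction R} -> Prop) :
  (forall n e n' e', e != 0 -> e' != 0 -> P (n%:F / e%:F) (n'%:F / e'%:F)) ->
  forall x y, P x y.
Proof. by move=> H x y; rewrite (fnum_fden x) (fnum_fden y); apply: H; apply: fden_neq0. Qed.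

Section LiftMorphism.
Variables (f : {rmorphism R -> R}) (f_inj : injective f).

(** The injectivity proof is part of the function, so that the morphism instances below can be
    attached to it; it keeps denominators nonzero. *)
Definition fracmap of injective f :=
  fun x : {fraction R} => (f (fnum x))%:F / (f (fden x))%:F.

Let f0 y : y != 0 -> (f y)%:F != 0.
Proof. by rewrite tofrac_eq0 raddf_eq0. Qed.

Lemma fracmap_div n e : e != 0 -> fracmap f_inj (n%:F / e%:F) = (f n)%:F / (f e)%:F.
Proof.
move=> e0; set x := _ / _; have xE := fnum_fden x.
apply/eqP; rewrite /fracmap eqr_div ?f0 ?fden_neq0 // -!rmorphM.
by rewrite (frac_eq e0 (fden_neq0 x) xE).
Qed.

Lemma fracmap_tofrac y : fracmap f_inj y%:F = (f y)%:F.
Proof. by rewrite -[y%:F]divr1 -tofrac1 fracmap_div ?oner_neq0 // rmorph1 rmorph1 divr1. Qed.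

Fact fracmap_is_zmod_morphism : zmod_morphism (fracmap f_inj).
Proof.
apply: frac_ind2 => n e n' e' e0 e0'.
rewrite fracN fracD // !fracmap_div ?mulf_neq0 // fracN fracD ?raddf_eq0 //.
by rewrite rmorphD !rmorphM rmorphN.
Qed.

Fact fracmap_is_monoid_morphism : monoid_morphism (fracmap f_inj).
Proof.
split; first by rewrite -tofrac1 fracmap_tofrac rmorph1.
apply: frac_ind2 => n e n' e' e0 e0'.
by rewrite fracM !fracmap_div ?mulf_neq0 // fracM !rmorphM.
Qed.

HB.instance Definition _ := GRing.isZmodMorphism.Build _ _ (fracmap f_inj)
  fracmap_is_zmod_morphism.
HB.instance Definition _ := GRing.isMonoidMorphism.Build _ _ (fracmap f_inj)
  fracmap_is_monoid_morphism.

End LiftMorphism.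

Section LiftDerivation.
Variable D : R -> R.
Hypotheses (DD : {morph D : x y / x + y}) (DM : forall x y, D (x * y) = D x * y + x * D y).

Definition fracder (x : {fraction R}) : {fraction R} :=
  (D (fnum x) * fden x - fnum x * D (fden x))%:F / (fden x ^+ 2)%:F.

(** The quotient rule does not depend on the chosen representative: differentiate the
    cross-multiplied equality [n * e' = n' * e]. *)
Lemma fracder_div n e : e != 0 ->
  fracder (n%:F / e%:F) = (D n * e - n * D e)%:F / (e ^+ 2)%:F.
Proof.
move=> e0; set x := _ / _; have xE := fnum_fden x.
have := frac_eq e0 (fden_neq0 x) xE; have := fden_neq0 x.
rewrite /fracder; move: (fnum x) (fden x) => n' e' e0' ne.
apply/eqP; rewrite eqr_div ?tofrac_neq0 ?expf_neq0 // -!rmorphM tofrac_eq; apply/eqP.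
have Dne : D n * e' + n * D e' = D n' * e + n' * D e by rewrite -!DM ne.
have {}Dne : D n * e' = D n' * e + n' * D e - n * D e' by rewrite -Dne addrK.
symmetry; transitivity (e' * (e * (D n * e') - n * e' * D e)); first by ring.
rewrite Dne ne; transitivity (e ^+ 2 * D n' * e' - e * (n * e') * D e'); first by ring.
by rewrite ne; ring.
Qed.

Lemma fracder_tofrac y : fracder y%:F = (D y)%:F.
Proof.
have D1 : D 1 = 0.
  by apply: (addrI (D 1)); rewrite addr0 -{3}[1]mulr1 DM mulr1 mul1r.
rewrite -[y%:F]divr1 -tofrac1 fracder_div ?oner_neq0 //.
by rewrite D1 mulr0 subr0 mulr1 expr1n rmorph1 divr1.
Qed.

Lemma fracderD : {morph fracder : x y / x + y}.
Proof.
apply: frac_ind2 => n e n' e' e0 e0'.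
rewrite fracD // !fracder_div ?mulf_neq0 // fracD ?expf_neq0 //.
apply: frac_congr; rewrite ?mulf_neq0 ?expf_neq0 ?mulf_neq0 // DD !DM.
by ring.
Qed.

Lemma fracderM x y : fracder (x * y) = fracder x * y + x * fracder y.
Proof.
move: x y; apply: frac_ind2 => n e n' e' e0 e0'.
rewrite fracM !fracder_div ?mulf_neq0 // !fracM fracD ?mulf_neq0 ?expf_neq0 //.
apply: frac_congr; rewrite ?mulf_neq0 ?expf_neq0 ?mulf_neq0 // !DM.
by ring.
Qed.

End LiftDerivation.
End FractionLifts.

Section FractionCoefficient.
Variables (F : fieldType) (n : nat) (m : 'X_{1..n}).
Local Notation R := {mpoly F[n]}.

Definition is_mpoly (x : {fraction R}) := exists P : R, P%:F = x.

(* [0] outside the image of the polynomials *)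
Definition fcoef (x : {fraction R}) : F :=
  match excluded_middle_informative (is_mpoly x) with
  | left h => (proj1_sig (constructive_indefinite_description _ h))@_m
  | right _ => 0
  end.

Lemma fcoef_tofrac (P : R) : fcoef P%:F = P@_m.
Proof.
rewrite /fcoef; case: excluded_middle_informative => [h|[]]; last by exists P.
case: constructive_indefinite_description => Q /= /eqP; rewrite tofrac_eq.
by move/eqP ->.
Qed.

Lemma is_mpoly1 : is_mpoly 1. Proof. by exists 1; rewrite rmorph1. Qed.

Lemma is_mpolyB x y : is_mpoly x -> is_mpoly y -> is_mpoly (x - y).
Proof. by move=> [P <-] [Q <-]; exists (P - Q); rewrite rmorphB. Qed.

Lemma is_mpolyM x y : is_mpoly x -> is_mpoly y -> is_mpoly (x * y).
Proof. by move=> [P <-] [Q <-]; exists (P * Q); rewrite rmorphM. Qed.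

Lemma fcoefB x y : is_mpoly x -> is_mpoly y -> fcoef (x - y) = fcoef x - fcoef y.
Proof.
by move=> [P <-] [Q <-]; rewrite -rmorphB !fcoef_tofrac raddfB.
Qed.

(** A derivative along [i] has at [m] the coefficient of the next monomial times [m i + 1]; this
    factor vanishing is Stokes in characteristic p. *)
Lemma mderiv_partial_derivation (i : 'I_n) : (m i).+1%:R = 0 :> F ->
  partial_derivation is_mpoly fcoef (fracder (mderiv i)).
Proof.
move=> mi; have DD := @mderivD n F i; have DM := @mderivM n F i.
split.
- exact: fracderD.
- exact: fracderM.
- by move=> x [P <-]; exists (mderiv i P); rewrite fracder_tofrac.
move=> x [P <-]; rewrite fracder_tofrac // fcoef_tofrac mcoeff_mderiv.
by rewrite -mulr_natr mi mulr0.
Qed.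

Lemma fcoef_msym (sg : 'S_n) x : (forall i, m (sg i) = m i) -> is_mpoly x ->
  fcoef (fracmap (@inj_msym n F sg) x) = fcoef x.
Proof.
move=> msg [P <-]; rewrite fracmap_tofrac !fcoef_tofrac mcoeff_sym.
by congr (_@_ _); apply/mnmP => i; rewrite mnmE msg.
Qed.

End FractionCoefficient.

(** * Permutations acting separately on the two blocks of variables *)

Section SumPermutation.
Variables (k1 k2 : nat) (sg : 'S_k1) (ta : 'S_k2).

Definition sum_perm_fun (sg : 'S_k1) (ta : 'S_k2) (i : 'I_(k1 + k2)) : 'I_(k1 + k2) :=
  unsplit (match split i with inl i => inl (sg i) | inr j => inr (ta j) end).

Lemma sum_perm_inj : injective (sum_perm_fun sg ta).
Proof.
apply: (can_inj (g := sum_perm_fun sg^-1 ta^-1)) => i.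
rewrite -[i in RHS]splitK /sum_perm_fun unsplitK.
by case: (split i) => j; rewrite permK.
Qed.

Definition sum_perm := perm sum_perm_inj.

Lemma sum_perm_lshift i : sum_perm (lshift k2 i) = lshift k2 (sg i).
Proof. by rewrite permE /sum_perm_fun (unsplitK (inl _ i)). Qed.

Lemma sum_perm_rshift i : sum_perm (rshift k1 i) = rshift k1 (ta i).
Proof. by rewrite permE /sum_perm_fun (unsplitK (inr _ i)). Qed.

End SumPermutation.

Section MpolyVariables.
Variables (F : fieldType) (n : nat).

Lemma mpolyX1_inj (i j : 'I_n) : 'X_i = 'X_j :> {mpoly F[n]} -> i = j.
Proof.
move/(congr1 (mcoeff U_(i))); rewrite !mcoeffX eqxx eq_mnm1.
by case: eqP => // _ /eqP; rewrite oner_eq0.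
Qed.

Lemma mpolyX1_neq0 (i : 'I_n) : 'X_i != 0 :> {mpoly F[n]}.
Proof.
apply/eqP => /(congr1 (mcoeff U_(i))); rewrite mcoeffX eqxx mcoeff0.
by move/eqP; rewrite oner_eq0.
Qed.

Lemma mpolyX1_neq1 (i : 'I_n) : 1 - 'X_i != 0 :> {mpoly F[n]}.
Proof.
apply/eqP => /(congr1 (mcoeff U_(i))); rewrite mcoeffB mcoeffX eqxx mcoeff0 mcoeff1.
rewrite mnm1_eq0 sub0r => /eqP; by rewrite oppr_eq0 oner_eq0.
Qed.

Lemma msymXU (sg : 'S_n) (i : 'I_n) : msym sg 'X_i = 'X_(sg i) :> {mpoly F[n]}.
Proof.
rewrite msymX; congr 'X_[_]; apply/mnmP => j; rewrite mnmE !mnm1E.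
by rewrite eq_sym (canF_eq (permKV sg)) eq_sym.
Qed.

Lemma mderivXU (i j : 'I_n) : mderiv i 'X_j = (j == i)%:R :> {mpoly F[n]}.
Proof.
rewrite mderivX mnm1E; case: eqP => [->|_]; last by rewrite scale0r.
rewrite scale1r -[RHS]mpolyX0; congr 'X_[_]; apply/mnmP => l.
by rewrite mnmBE subnn mnm0E.
Qed.

End MpolyVariables.

(** * The recursion for the coefficient over the prime field *)

Section Recursion.
Variables (p d k a b1 b2 c : nat).
Hypotheses (p_pr : prime p) (p_odd : odd p).
Hypotheses (a_gt0 : (0 < a)%N) (c_gt0 : (0 < c)%N) (c_ltp : (c < p)%N) (k1_gt0 : (0 < d + k)%N).
Local Notation k1 := (d + k)%N.
Local Notation t := (@tvar p (d + k) k).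
Local Notation s := (@svar p (d + k) k).
Local Notation E := (fcoef (mono000 p (d + k) k)).
Local Notation W := (weighted t s a b1 b2 (p - c) c).

Lemma Fp_p : p%:R = 0 :> 'F_p.
Proof. exact: (pcharf0 (pchar_Fp p_pr)). Qed.

Lemma FR_p (k1 k2 : nat) : p%:R = 0 :> FR p k1 k2.
Proof.
rewrite -(rmorph_nat (@FracField.tofrac (PR p k1 k2))).
have -> : p%:R = 0 :> PR p k1 k2 by rewrite -mpolyC_nat Fp_p mpolyC0.
by rewrite rmorph0.
Qed.

Lemma mono000_lshift (k1 k2 : nat) i : mono000 p k1 k2 (lshift k2 i) = (p - 1)%N.
Proof. by rewrite mnmE /= ltn_ord. Qed.

Lemma mono000_rshift (k1 k2 : nat) i : mono000 p k1 k2 (rshift k1 i) = (k1 * p - 1)%N.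
Proof. by rewrite mnmE /= ltnNge leq_addr. Qed.

Lemma mono000_succ (k1 k2 : nat) (i : 'I_(k1 + k2)) : (0 < k1)%N ->
  (mono000 p k1 k2 i).+1%:R = 0 :> 'F_p.
Proof.
move=> k_gt0; have p_gt0 := prime_gt0 p_pr.
case: (split_ordP i) => j ->.
  by rewrite mono000_lshift -subSn // subn1 Fp_p.
by rewrite mono000_rshift -subSn ?muln_gt0 ?k_gt0 // subn1 natrM Fp_p mulr0.
Qed.

Definition permute_vars (k1 k2 : nat) (sg : 'S_k1) (ta : 'S_k2) :
    {rmorphism FR p k1 k2 -> FR p k1 k2} :=
  fracmap (@inj_msym _ 'F_p (sum_perm sg ta)).

Lemma permute_tvar (k1 k2 : nat) (sg : 'S_k1) (ta : 'S_k2) i :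
  permute_vars sg ta (@tvar p k1 k2 i) = @tvar p k1 k2 (sg i).
Proof. by rewrite /permute_vars /= /tvar fracmap_tofrac /= msymXU sum_perm_lshift. Qed.

Lemma permute_svar (k1 k2 : nat) (sg : 'S_k1) (ta : 'S_k2) j :
  permute_vars sg ta (@svar p k1 k2 j) = @svar p k1 k2 (ta j).
Proof. by rewrite /permute_vars /= /svar fracmap_tofrac /= msymXU sum_perm_rshift. Qed.

Lemma is_mpoly_permute (k1 k2 : nat) (sg : 'S_k1) (ta : 'S_k2) x :
  is_mpoly x -> is_mpoly (permute_vars sg ta x).
Proof.
by move=> [P <-]; exists (msym (sum_perm sg ta) P); rewrite /permute_vars /= fracmap_tofrac.
Qed.

Lemma fcoef_permute (k1 k2 : nat) (sg : 'S_k1) (ta : 'S_k2) x :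
  is_mpoly x -> fcoef (mono000 p k1 k2) (permute_vars sg ta x) = fcoef (mono000 p k1 k2) x.
Proof.
move=> Ix; apply: fcoef_msym => // i; case: (split_ordP i) => j ->.
  by rewrite sum_perm_lshift !mono000_lshift.
by rewrite sum_perm_rshift !mono000_rshift.
Qed.

Lemma svar_sub_tvar_neq0 (k1 k2 : nat) i j : @svar p k1 k2 j - @tvar p k1 k2 i != 0.
Proof.
rewrite subr_eq0 tofrac_eq; apply/eqP => /mpolyX1_inj /eqP.
by rewrite eq_rlshift.
Qed.

Lemma tvar_neq0 (k1 k2 : nat) i : @tvar p k1 k2 i != 0.
Proof. by rewrite tofrac_eq0 mpolyX1_neq0. Qed.

Lemma one_sub_tvar_neq0 (k1 k2 : nat) i : 1 - @tvar p k1 k2 i != 0.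
Proof. by rewrite -tofrac1 -tofracB tofrac_eq0 mpolyX1_neq1. Qed.

Lemma one_sub_svar_neq0 (k1 k2 : nat) j : 1 - @svar p k1 k2 j != 0.
Proof. by rewrite -tofrac1 -tofracB tofrac_eq0 mpolyX1_neq1. Qed.

Lemma recursion_Fp :
  (\prod_(n < d + k) (a%:R + n%:R * c%:R)) * E (W (d + k)%N) =
  (\prod_(n < d) (a%:R + 1 + b1%:R + ((d + k)%:R - 1 + n%:R) * c%:R))
  * (\prod_(j < k) (a%:R + 1 + b1%:R + b2%:R + ((d + k)%:R - 2%:R + j%:R) * c%:R))
  * E (W 0).
Proof.
have IX (i : 'I_(k1 + k)) : is_mpoly ('X_i : PR p k1 k)%:F by exists 'X_i.
have V2 : 2%:R != 0 :> 'F_p.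
  rewrite -(dvdn_pcharf (pchar_Fp p_pr)); apply/negP => /(dvdn_leq (isT : 0 < 2)%N).
  by move: p_pr p_odd; case: p => [|[|[|]]].
have DD := @mderivD (k1 + k) 'F_p; have DM := @mderivM (k1 + k) 'F_p.
apply: (@weighted_recursion (FR p k1 k) 'F_p (@is_mpoly _ _) E
  (is_mpoly1 _ _) (@is_mpolyB _ _) (@is_mpolyM _ _) (@fcoefB _ _ _) d k t s _ _ _ _
  _ _ _ _ a b1 b2 (p - c) c _ _ _ _ _ (@permute_vars k1 k) _ _ _ _
  (fun i => fracder (mderiv (lshift k i))) (fun j => fracder (mderiv (rshift k1 j)))) => //.
- by move=> i; apply: IX.
- by move=> j; apply: IX.
- by move=> i j /eqP; rewrite tofrac_eq => /eqP /mpolyX1_inj /lshift_inj.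
- by move=> i j /eqP; rewrite tofrac_eq => /eqP /mpolyX1_inj /rshift_inj.
- exact: svar_sub_tvar_neq0.
- exact: tvar_neq0.
- exact: one_sub_tvar_neq0.
- exact: one_sub_svar_neq0.
- by rewrite subn_gt0.
- by rewrite natrB ?(ltnW c_ltp) // FR_p sub0r.
- exact: permute_tvar.
- exact: permute_svar.
- exact: is_mpoly_permute.
- exact: fcoef_permute.
- by move=> i; apply: mderiv_partial_derivation; apply: mono000_succ.
- by move=> j; apply: mderiv_partial_derivation; apply: mono000_succ.
- move=> i i'; rewrite fracder_tofrac // mderivXU rmorph_nat.
  by rewrite (inj_eq (@lshift_inj k1 k)).
- by move=> i j; rewrite fracder_tofrac // mderivXU eq_rlshift rmorph0.
- by move=> i j; rewrite fracder_tofrac // mderivXU eq_lrshift rmorph0.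
- move=> j j'; rewrite fracder_tofrac // mderivXU rmorph_nat.
  by rewrite (inj_eq (@rshift_inj k1 k)).
Qed.

End Recursion.

(** * Splitting the variables into two blocks *)

Section SplitVariables.
Variables (F : fieldType) (n1 n2 : nat).

Definition mcat (m1 : 'X_{1..n1}) (m2 : 'X_{1..n2}) : 'X_{1..n1 + n2} :=
  [multinom (match split i with inl j => m1 j | inr j => m2 j end) | i < n1 + n2].

Lemma mcat_lshift m1 m2 i : mcat m1 m2 (lshift n2 i) = m1 i.
Proof. by rewrite mnmE (unsplitK (inl _ i)). Qed.

Lemma mcat_rshift m1 m2 i : mcat m1 m2 (rshift n1 i) = m2 i.
Proof. by rewrite mnmE (unsplitK (inr _ i)). Qed.

Lemma mcatP (m : 'X_{1..n1 + n2}) (m1 : 'X_{1..n1}) (m2 : 'X_{1..n2}) :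
  (forall i, m (lshift n2 i) = m1 i) ->
  (forall j, m (rshift n1 j) = m2 j) -> m = mcat m1 m2.
Proof.
move=> ml mr; apply/mnmP => i; case: (split_ordP i) => j ->.
  by rewrite mcat_lshift.
by rewrite mcat_rshift.
Qed.

Lemma mcat_surj (m : 'X_{1..n1 + n2}) : exists m1 m2, m = mcat m1 m2.
Proof.
exists [multinom m (lshift n2 i) | i < n1], [multinom m (rshift n1 j) | j < n2].
by apply: mcatP => i; rewrite mnmE.
Qed.

Lemma mcat_eq m1 m2 m1' m2' : (mcat m1 m2 == mcat m1' m2') = (m1 == m1') && (m2 == m2').
Proof.
apply/eqP/andP => [eqm|[/eqP -> /eqP ->] //]; split; apply/eqP/mnmP => i.
  by rewrite -(mcat_lshift m1 m2) eqm mcat_lshift.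
by rewrite -(mcat_rshift m1 m2) eqm mcat_rshift.
Qed.

Lemma mcatD m1 m2 m1' m2' : (mcat m1 m2 + mcat m1' m2')%MM = mcat (m1 + m1')%MM (m2 + m2')%MM.
Proof.
by apply: mcatP => i; rewrite !mnmDE ?mcat_lshift ?mcat_rshift.
Qed.

Lemma mdeg_mcat m1 m2 : mdeg (mcat m1 m2) = (mdeg m1 + mdeg m2)%N.
Proof.
rewrite !mdegE big_split_ord /=; congr (_ + _)%N; apply: eq_bigr => i _.
  by rewrite mcat_lshift.
by rewrite mcat_rshift.
Qed.

Definition mlift (P : {mpoly F[n1]}) : {mpoly F[n1 + n2]} :=
  P \mPo [tuple 'X_(lshift n2 i) | i < n1].

HB.instance Definition _ := GRing.RMorphism.copy mlift
  (comp_mpoly [tuple 'X_(lshift n2 i) : {mpoly F[n1 + n2]} | i < n1]).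

Lemma mliftX m : mlift 'X_[m] = 'X_[mcat m 0%MM].
Proof.
rewrite /mlift comp_mpolyX mpolyXE_id big_split_ord /= [X in _ * X]big1 ?mulr1.
  by apply: eq_bigr => i _; rewrite tnth_mktuple mcat_lshift.
by move=> j _; rewrite mcat_rshift mnm0E expr0.
Qed.

Definition mkill (P : {mpoly F[n1 + n2]}) : {mpoly F[n2]} :=
  P \mPo [tuple (match split i with inl _ => 0 | inr j => 'X_j end) | i < n1 + n2].

HB.instance Definition _ := GRing.RMorphism.copy mkill
  (comp_mpoly [tuple (match split i with inl _ => 0 | inr j => 'X_j end : {mpoly F[n2]})
    | i < n1 + n2]).

Lemma mkillX m1 m2 : mkill 'X_[mcat m1 m2] = (m1 == 0%MM)%:R * 'X_[m2].
Proof.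
rewrite /mkill comp_mpolyX big_split_ord /=; congr (_ * _); last first.
  rewrite mpolyXE_id; apply: eq_bigr => i _.
  by rewrite tnth_mktuple (unsplitK (inr _ i)) mcat_rshift.
have [->|m1n0] := eqVneq.
  by rewrite big1 // => i _; rewrite mcat_lshift mnm0E expr0.
have [i m1i] : exists i, m1 i != 0%N.
  apply/existsP; apply: contraNT m1n0; rewrite negb_exists => /forallP m10.
  by apply/eqP/mnmP => i; rewrite mnm0E; apply/eqP; have := m10 i; rewrite negbK.
rewrite (bigD1 i) //= tnth_mktuple (unsplitK (inl _ i)) mcat_lshift expr0n.
by rewrite (negbTE m1i) mul0r.
Qed.

Lemma mcoeff_mkill P m2 : (mkill P)@_m2 = P@_(mcat 0%MM m2).
Proof.
rewrite /mkill comp_mpolyEX [P in RHS]mpolyE !raddf_sum; apply: eq_bigr => m _.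
rewrite /= -/(mkill _) !mcoeffZ; congr (_ * _).
have [m1 [m2' ->]] := mcat_surj m; rewrite mkillX mcoeffX mcat_eq.
case: (m1 == 0%MM); last by rewrite mul0r mcoeff0.
by rewrite mul1r mcoeffX.
Qed.

Lemma mcoeff_mlift P m1 : (mlift P)@_(mcat m1 0%MM) = P@_m1.
Proof.
rewrite /mlift comp_mpolyEX [P in RHS]mpolyE !raddf_sum; apply: eq_bigr => m _.
rewrite /= -/(mlift _) !mcoeffZ mliftX !mcoeffX mcat_eq.
by rewrite eqxx andbT.
Qed.

(** [H] already has the full degree of [m1] in the first block, so only the terms of [Q] free of
    that block can contribute. *)
Lemma mcoeff_mliftM (H : {mpoly F[n1]}) (Q : {mpoly F[n1 + n2]}) m1 m2 :
  H \is (mdeg m1).-homog ->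
  (mlift H * Q)@_(mcat m1 m2) = H@_m1 * (mkill Q)@_m2.
Proof.
move=> /dhomogP homH.
rewrite mcoeff_mkill /mlift comp_mpolyEX [H in RHS]mpolyE mulr_suml !raddf_sum mulr_suml.
apply: eq_big_seq => m mH; rewrite /= -/(mlift _) -scalerAl !mcoeffZ -mulrA.
congr (_ * _); rewrite mliftX mcoeffX.
rewrite [Q in LHS]mpolyE [Q in RHS]mpolyE mulr_sumr !raddf_sum mulr_sumr.
apply: eq_bigr => q _; rewrite /= -scalerAr !mcoeffZ mulrCA; congr (_ * _).
have [u [v ->]] := mcat_surj q; rewrite -mpolyXD mcatD add0m !mcoeffX !mcat_eq.
have [_|_] := eqVneq v m2; rewrite ?andbF ?mulr0 // !andbT.
rewrite -natrM mulnb; congr (_%:R : F); congr nat_of_bool.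
apply/eqP/andP => [mu|[/eqP -> /eqP ->]]; last by rewrite addm0.
have /eqP : mdeg (m + u) = mdeg m by rewrite mu homH.
rewrite mdegD -[X in _ == X]addn0 eqn_add2l mdeg_eq0 => /eqP u0.
by rewrite -mu u0 addm0.
Qed.

Definition dehomogenize (P : {mpoly F[n1 + n2]}) : {mpoly F[n1]} :=
  P \mPo [tuple (match split i with inl j => 'X_j | inr _ => 1 end) | i < n1 + n2].

Lemma dehomogenizeX m1 m2 : dehomogenize 'X_[mcat m1 m2] = 'X_[m1].
Proof.
rewrite /dehomogenize comp_mpolyX big_split_ord /= mpolyXE_id.
rewrite [X in _ * X]big1 ?mulr1 => [|j _]; last first.
  by rewrite tnth_mktuple (unsplitK (inr _ j)) expr1n.
by apply: eq_bigr => i _; rewrite tnth_mktuple (unsplitK (inl _ i)) mcat_lshift.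
Qed.

End SplitVariables.

(** Setting one variable to 1 loses nothing: homogeneity restores its exponent. This is why the
    second block has size one. *)
Lemma mcoeff_dehomogenize (F : fieldType) n (P : {mpoly F[n + 1]}) m1 m2 :
  P \is (mdeg (mcat m1 m2)).-homog -> (dehomogenize P)@_m1 = P@_(mcat m1 m2).
Proof.
move=> /dhomogP homP.
rewrite /dehomogenize comp_mpolyEX [P in RHS]mpolyE !raddf_sum.
apply: eq_big_seq => m mP; rewrite /= -/(dehomogenize _) !mcoeffZ.
congr (_ * _); have : mdeg m = mdeg (mcat m1 m2) := homP m mP.
have [u [v ->]] := mcat_surj m; rewrite dehomogenizeX !mcoeffX mcat_eq !mdeg_mcat.
have [->|//] := eqVneq u m1; move/eqP.
rewrite eqn_add2l !mdegE !big_ord1 => /eqP vm2.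
suff -> : v = m2 by rewrite eqxx.
by apply/mnmP => i; rewrite (ord1 i).
Qed.

(** * Dyson and Morris constant terms *)

Section Constants.
Variables (F : fieldType) (c : nat).

Definition cmnm (n e : nat) : 'X_{1..n} := [multinom e | i < n].

Definition xvanderm n : {mpoly F[n]} := vanderm c (fun i : 'I_n => 'X_i).

(** Dyson's constant term of the product of (1 - x_j / x_i)^c over i <> j: each x_i is cleared of
    denominators by the power (n-1) c. *)
Definition dyson n : F := (xvanderm n)@_(cmnm n (n.-1 * c)).

(** Morris' constant term in polynomial form; the exponent [e] plays the part of the Laurent
    monomial. *)
Definition morris n e b : F :=
  ((\prod_(i < n) (1 - 'X_i) ^+ b) * xvanderm n)@_(cmnm n e).

Lemma mdeg_cmnm n e : mdeg (cmnm n e) = (n * e)%N.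
Proof.
rewrite mdegE (eq_bigr (fun=> e)) => [|i _]; last by rewrite mnmE.
by rewrite sum_nat_const card_ord.
Qed.

Lemma cmnmD n e e' : (cmnm n e + cmnm n e')%MM = cmnm n (e + e').
Proof. by apply/mnmP => i; rewrite mnmDE !mnmE. Qed.

Lemma mpolyX_cmnm n e : 'X_[cmnm n e] = \prod_(i < n) 'X_i ^+ e :> {mpoly F[n]}.
Proof. by rewrite mpolyXE_id; apply: eq_bigr => i _; rewrite mnmE. Qed.

Lemma mcoeff_mul_cmnm n (P : {mpoly F[n]}) e e' :
  ((\prod_(i < n) 'X_i ^+ e) * P)@_(cmnm n (e + e')) = P@_(cmnm n e').
Proof. by rewrite -mpolyX_cmnm mulrC -cmnmD mcoeffMX. Qed.

Lemma dhomog_prod_sum n (I : finType) (P : pred I) (e : I -> nat) (y : I -> {mpoly F[n]}) :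
  (forall i, P i -> y i \is (e i).-homog) ->
  \prod_(i | P i) y i \is (\sum_(i | P i) e i).-homog.
Proof.
move=> yh; apply: (big_rec2 (fun p q => p \is q.-homog)) => [|i q p Pi ph].
  exact: dhomog1.
by rewrite dhomogM ?yh.
Qed.

Lemma dhomog_xvanderm n : xvanderm n \is (n * (n.-1 * c)).-homog.
Proof.
have -> : (n * (n.-1 * c) = \sum_(i < n) \sum_(i' < n | i' != i) c)%N.
  rewrite (eq_bigr (fun=> (n.-1 * c)%N)) => [|i _].
    by rewrite sum_nat_const card_ord.
  by rewrite sum_nat_const cardC1 card_ord.
apply: dhomog_prod_sum => i _; apply: dhomog_prod_sum => j _.
rewrite -[X in X.-homog]mul1n; apply: dhomogMn.
by apply: rpredB; rewrite dhomogX; apply/eqP/mdeg1.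
Qed.

Lemma dyson0 : dyson 0 = 1.
Proof.
rewrite /dyson /xvanderm /vanderm big_ord0 mcoeff1.
by rewrite (_ : cmnm _ _ = 0%MM) ?eqxx //; apply/mnmP => -[].
Qed.

Lemma morris0 e b : morris 0 e b = 1.
Proof.
rewrite /morris /xvanderm /vanderm !big_ord0 mulr1 mcoeff1.
by rewrite (_ : cmnm _ _ = 0%MM) ?eqxx //; apply/mnmP => -[].
Qed.

(** With the last variable set to 1, its two ordered pairs with x_i give (1 - x_i)^c (x_i - 1)^c.
    This explains both the exponent [2 * c] and the sign. *)
Lemma dysonS n : dyson n.+1 = (-1) ^+ (n * c) * morris n (n * c) (2 * c).
Proof.
have -> : dyson n.+1 = dyson (n + 1) by rewrite addn1.
have mE : cmnm (n + 1) ((n + 1).-1 * c) = mcat (cmnm n (n * c)) (cmnm 1 (n * c)).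
  by apply: mcatP => i; rewrite !mnmE addn1.
rewrite /dyson mE -mcoeff_dehomogenize; last first.
  rewrite -mE mdeg_cmnm; exact: dhomog_xvanderm.
have -> : dehomogenize (xvanderm (n + 1)) = (-1) ^+ (n * c) *
    ((\prod_(i < n) (1 - 'X_i) ^+ (2 * c)) * xvanderm n).
  pose y (i : 'I_(n + 1)) : {mpoly F[n]} :=
    match split i with inl j => 'X_j | inr _ => 1 end.
  have yl i : y (lshift 1 i) = 'X_i by rewrite /y (unsplitK (inl _ i)).
  have yr i : y (rshift n i) = 1 by rewrite /y (unsplitK (inr _ i)).
  have -> : dehomogenize (xvanderm (n + 1)) = vanderm c y.
    rewrite /dehomogenize /xvanderm rmorph_vanderm /vanderm.
    apply: eq_bigr => i _; apply: eq_bigr => j _.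
    by rewrite /= !comp_mpolyXU -!tnth_nth !tnth_mktuple.
  rewrite /vanderm big_split_ord big_ord1 /= /xvanderm /vanderm.
  have -> : \prod_(i | i != rshift n ord0) (y (rshift n ord0) - y i) ^+ c
      = \prod_(i < n) (1 - 'X_i) ^+ c.
    rewrite big_split_ord /= [X in _ * X]big1 ?mulr1 => [|i].
      by apply: eq_big => [i|i _]; rewrite ?eq_lrshift // yl yr.
    by rewrite (ord1 i) eqxx.
  have -> : \prod_(i < n) \prod_(i' | i' != lshift 1 i) (y (lshift 1 i) - y i') ^+ c =
    \prod_(i < n) ((\prod_(i' | i' != i) ('X_i - 'X_i') ^+ c) * ('X_i - 1) ^+ c).
    apply: eq_bigr => i _; rewrite big_split_ord /= big_ord1_cond eq_rlshift /= yl yr.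
    congr (_ * _); apply: eq_big => [j|j _]; first by rewrite (inj_eq (@lshift_inj n 1)).
    by rewrite yl.
  have CA : \prod_(i < n) ('X_i - 1) ^+ c * \prod_(i < n) (1 - 'X_i) ^+ c =
      (-1) ^+ (n * c) * \prod_(i < n) (1 - 'X_i) ^+ (2 * c) :> {mpoly F[n]}.
    rewrite mulnC exprM -[X in _ ^+ X]card_ord -prodr_const -!big_split /=.
    apply: eq_bigr => i _; rewrite mul2n -addnn exprD mulrA; congr (_ * _).
    by rewrite -exprMn; congr (_ ^+ _); ring.
  by rewrite big_split /= -mulrA CA mulrCA; congr (_ * _); rewrite mulrC.
rewrite /morris -signr_odd -[X in _ = X * _]signr_odd.
case: (odd _); last by rewrite !expr0 !mul1r.
by rewrite !expr1 !mulN1r mcoeffN.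
Qed.

End Constants.

Lemma eq_vanderm (R : comNzRingType) (I : finType) c (y z : I -> R) :
  y =1 z -> vanderm c y = vanderm c z.
Proof. by move=> yz; apply: eq_bigr => i _; apply: eq_bigr => j _; rewrite !yz. Qed.

Section VariableImages.
Variables (F : fieldType) (n1 n2 : nat).

Lemma mliftXU i : mlift n2 ('X_i : {mpoly F[n1]}) = 'X_(lshift n2 i).
Proof. by rewrite /mlift comp_mpolyXU -tnth_nth tnth_mktuple. Qed.

Lemma mkillXl i : mkill ('X_(lshift n2 i) : {mpoly F[n1 + n2]}) = 0.
Proof. by rewrite /mkill comp_mpolyXU -tnth_nth tnth_mktuple (unsplitK (inl _ i)). Qed.

Lemma mkillXr i : mkill ('X_(rshift n1 i) : {mpoly F[n1 + n2]}) = 'X_i.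
Proof. by rewrite /mkill comp_mpolyXU -tnth_nth tnth_mktuple (unsplitK (inr _ i)). Qed.

End VariableImages.

Section InitialValue.
Variables (p d k a b1 b2 c : nat).
Hypotheses (p_pr : prime p) (a_gt0 : (0 < a)%N) (c_gt0 : (0 < c)%N) (c_ltp : (c < p)%N).
Local Notation k1 := (d + k)%N.
Local Notation t := (@tvar p (d + k) k).
Local Notation s := (@svar p (d + k) k).
Local Notation E := (fcoef (mono000 p (d + k) k)).
Local Notation W := (weighted t s a b1 b2 (p - c) c).

Definition tpoly : {mpoly 'F_p[k1]} := \prod_i 'X_i ^+ a.-1 * xvanderm _ c k1.

Definition stpoly : PR p k1 k :=
  (\prod_i (1 - 'X_(lshift k i)) ^+ b1) * (\prod_j (1 - 'X_(rshift k1 j)) ^+ b2)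
  * (\prod_i \prod_j ('X_(rshift k1 j) - 'X_(lshift k i)) ^+ (p - c - (i == rshift d j)))
  * vanderm c (fun j => 'X_(rshift k1 j)).

Lemma weighted_mpoly : W (d + k)%N = (mlift k tpoly * stpoly)%:F.
Proof.
rewrite weighted_full ?subn_gt0 //; last 2 first.
- exact: tvar_neq0.
- exact: svar_sub_tvar_neq0.
rewrite tofracM /stpoly !tofracM rmorph_vanderm; congr (_ * (_ * _ * _ * _)).
- rewrite /tpoly rmorphM rmorph_vanderm rmorph_prod tofracM rmorph_vanderm.
  rewrite rmorph_prod; congr (_ * _).
    by apply: eq_bigr => i _; rewrite rmorphXn /= mliftXU ?tofracXn ?rmorphXn.
  by apply: eq_vanderm => i; rewrite /= mliftXU.
- by rewrite rmorph_prod; apply: eq_bigr => i _; rewrite rmorphXn rmorphB rmorph1.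
- by rewrite rmorph_prod; apply: eq_bigr => i _; rewrite rmorphXn rmorphB rmorph1.
rewrite rmorph_prod; apply: eq_bigr => i _; rewrite rmorph_prod.
by apply: eq_bigr => j _; rewrite rmorphXn rmorphB.
Qed.

Lemma mono000E : mono000 p k1 k = mcat (cmnm k1 (p - 1)) (cmnm k (k1 * p - 1)).
Proof.
by apply: mcatP => i; rewrite ?mono000_lshift ?mono000_rshift mnmE.
Qed.

Lemma mcoeff_tpoly e : tpoly@_(cmnm k1 (a.-1 + e)) = (xvanderm 'F_p c k1)@_(cmnm k1 e).
Proof. exact: mcoeff_mul_cmnm. Qed.

(** At t = 0 the [k1] factors containing s_j merge into one power of s_j; the partner of s_j has
    lost one unit, hence the predecessor. *)
Lemma mkill_stpoly : (0 < k1)%N -> mkill stpoly =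
  \prod_(j < k) 'X_j ^+ (k1 * (p - c)).-1
    * (\prod_(j < k) (1 - 'X_j) ^+ b2 * xvanderm 'F_p c k).
Proof.
move=> k1_gt0; rewrite /stpoly !rmorphM rmorph_vanderm !rmorph_prod /=.
rewrite [X in X * _ * _ * _]big1 ?mul1r => [|i _]; last first.
  by rewrite rmorphXn rmorphB rmorph1 /= mkillXl subr0 expr1n.
rewrite mulrAC mulrC; congr (_ * (_ * _)); last first.
- by apply: eq_vanderm => j; rewrite /= mkillXr.
- by apply: eq_bigr => i _; rewrite rmorphXn rmorphB rmorph1 /= mkillXr.
under eq_bigr => i _ do rewrite rmorph_prod /=.
rewrite exchange_big /=; apply: eq_bigr => j _.
transitivity (\prod_(i < k1) 'X_j ^+ (p - c - (i == rshift d j)) : {mpoly 'F_p[k]}).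
  by apply: eq_bigr => i _; rewrite rmorphXn rmorphB /= mkillXr /= mkillXl subr0.
rewrite prodrXr; congr (_ ^+ _).
rewrite (bigD1 (rshift d j)) //= eqxx subn1.
rewrite (eq_bigr (fun=> (p - c)%N)) => [|i /negbTE ->]; last by rewrite subn0.
rewrite sum_nat_const cardC1 card_ord.
have : (0 < p - c)%N by rewrite subn_gt0.
by case: (p - c)%N => // q _; case: (d + k)%N k1_gt0 => // n _ /=; rewrite mulSn.
Qed.

(* [tpoly] already has the full degree [k1 * (p - 1)] in [t], so only the constant term
   in [t] of the other factor contributes. *)
Lemma weighted_initial : (a + k1.-1 * c = p)%N -> (k1 * c < p)%N -> (0 < k1)%N ->
  E (W (d + k)%N) = dyson 'F_p c k1 * morris 'F_p c k (k1 * c) b2.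
Proof.
move=> ap k1c k1_gt0; have p_gt0 := prime_gt0 p_pr.
rewrite weighted_mpoly fcoef_tofrac mono000E mcoeff_mliftM; last first.
  rewrite mdeg_cmnm /tpoly.
  have -> : (k1 * (p - 1) = \sum_(i < k1) a.-1 + k1 * (k1.-1 * c))%N.
    by rewrite sum_nat_const card_ord -mulnDr; congr (_ * _)%N; lia.
  rewrite dhomogM ?dhomog_xvanderm //; apply: dhomog_prod_sum => i _.
  by rewrite -[X in X.-homog]mul1n; apply: dhomogMn; rewrite dhomogX; apply/eqP/mdeg1.
have -> : (p - 1 = a.-1 + k1.-1 * c)%N by lia.
rewrite mcoeff_tpoly -/(dyson _ _ _) mkill_stpoly //; congr (_ * _).
(* The power of s_j gathered at t = 0 leaves [k1 * c] of the required exponent, which becomes the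
   exponent of the Morris term. *)
have -> : (k1 * p - 1 = (k1 * (p - c)).-1 + k1 * c)%N.
  have : (0 < k1 * (p - c))%N by rewrite muln_gt0 k1_gt0 subn_gt0.
  have : (k1 * p = k1 * (p - c) + k1 * c)%N by rewrite -mulnDr subnK // ltnW.
  by lia.
by rewrite mcoeff_mul_cmnm.
Qed.

End InitialValue.

(** Without s-variables, the power [a - 1] of each t leaves [p - a] of the exponent [p - 1]. *)
Lemma weighted_morris (p n a b1 b2 c : nat) : prime p -> (0 < a <= p)%N -> (c < p)%N ->
  fcoef (mono000 p (n + 0) 0)
    (weighted (@tvar p (n + 0) 0) (@svar p (n + 0) 0) a b1 b2 (p - c) c (n + 0))
  = morris 'F_p c n (p - a) b1.
Proof.
move=> p_pr /andP[a_gt0 a_lep] c_ltp.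
rewrite weighted_mpoly // fcoef_tofrac mono000E.
have -> : stpoly p n 0 b1 b2 c = mlift 0 (\prod_(i < n + 0) (1 - 'X_i) ^+ b1).
  rewrite /stpoly /vanderm [X in _ * X * _]big1 => [|i _]; last by rewrite big_ord0.
  rewrite !big_ord0 !mulr1 rmorph_prod; apply: eq_bigr => i _.
  by rewrite rmorphXn rmorphB rmorph1 /= mliftXU.
rewrite -rmorphM.
have -> : cmnm 0 ((n + 0) * p - 1) = 0%MM by apply/mnmP => -[].
rewrite mcoeff_mlift /tpoly -mulrA.
have -> : (p - 1 = a.-1 + (p - a))%N by lia.
by rewrite mcoeff_mul_cmnm [xvanderm _ _ _ * _]mulrC addn0.
Qed.

(** * Closed forms *)

Section Factorials.
Variables (p : nat).
Hypothesis p_pr : prime p.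

Definition factF (n : nat) : 'F_p := (n`!)%:R.

Lemma natF_eq0 n : (n%:R == 0 :> 'F_p) = (p %| n)%N.
Proof. by rewrite (dvdn_pcharf (pchar_Fp p_pr)). Qed.

Lemma factF_neq0 n : (n < p)%N -> factF n != 0.
Proof.
move=> np; rewrite /factF natF_eq0; elim: n np => [|n IHn] np.
  by rewrite fact0 dvdn1; case: p p_pr np => [|[|q]].
rewrite factS Euclid_dvdM // negb_or IHn 1?ltnW // andbT.
by rewrite gtnNdvd.
Qed.

Lemma factFS n : factF n.+1 = n.+1%:R * factF n.
Proof. by rewrite /factF factS natrM. Qed.

(** Starts from Wilson's theorem at 0. Passing from x to x + 1 trades the factor p - 1 - x for x +
    1, which is its negative mod p. *)
Lemma wilsonF x : (x < p)%N -> factF (p.-1 - x) * factF x = (-1) ^+ x.+1.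
Proof.
elim: x => [|x IHx] xp.
  have p_gt1 := prime_gt1 p_pr.
  have : (factF p.-1 + 1 == 0) by rewrite /factF natr1 natF_eq0 -Wilson.
  by rewrite subn0 /factF fact0 mulr1 expr1 addr_eq0 => /eqP.
have -> : (-1) ^+ x.+2 = - (factF (p.-1 - x) * factF x).
  by rewrite IHx 1?ltnW // exprS mulN1r.
have -> : (p.-1 - x = (p.-1 - x.+1).+1)%N by lia.
rewrite !factFS.
have -> : x.+1%:R = - (p.-1 - x.+1).+1%:R :> 'F_p; last by ring.
by apply/eqP; rewrite -addr_eq0 -natrD natF_eq0; have -> : (x.+1 + (p.-1 - x.+1).+1 = p)%N by lia.
Qed.

End Factorials.

Lemma weighted_shift (K : fieldType) d k (t : 'I_(d + k) -> K) s a b1 b2 m c :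
  (forall i, t i != 0) ->
  weighted t s a b1 b2 m c 0 = weighted t s a.+1 b1 b2 m c (d + k).
Proof.
move=> t0; rewrite /weighted /density.
have -> : invt t 0 = 1 by rewrite /invt big_pred0.
have <- : (\prod_i t i ^+ a.+1) * invt t (d + k) = \prod_i t i ^+ a.
  rewrite /invt [X in _ * X]big_mkcond -big_split /=.
  by apply: eq_bigr => i _; rewrite ltn_ord exprSr mulfK.
by ring.
Qed.

Section ClosedForm.
Variables (p d k b1 b2 c : nat).
Hypotheses (p_pr : prime p) (p_odd : odd p) (c_gt0 : (0 < c)%N) (c_ltp : (c < p)%N)
  (k1_gt0 : (0 < d + k)%N).
Local Notation k1 := (d + k)%N.
Local Notation fa := (factF p).

Definition selberg (a : nat) : 'F_p := fcoef (mono000 p (d + k) k)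
  (weighted (@tvar p (d + k) k) (@svar p (d + k) k) a b1 b2 (p - c) c (d + k)).

(** [X] and [Y] are the factorials of the theorem that depend on [a] and stand in denominators, [Z]
    those in the numerator, with indices from 0. In [Y], subtracting [p + 2 * c] at the end avoids
    truncating [k1 - 2]. *)
Let X a := \prod_(i < d) fa (a + b1 + (i + k1.-1) * c - p).
Let Y a := \prod_(i < k) fa (a + b1 + b2 + (i + k1) * c - (p + 2 * c)).
Let Z a := \prod_(i < k1) fa (a + i * c - 1).

Let Z_neq0 a : (a + k1.-1 * c <= p)%N -> (0 < a)%N -> Z a != 0.
Proof.
move=> ap a_gt0; apply/prodf_neq0 => i _; apply: factF_neq0 => //.
have : (i * c <= k1.-1 * c)%N by rewrite leq_mul2r; case: i => i /= ik; lia.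
by lia.
Qed.

Let FpN n : (n%:R + p%:R = n%:R :> 'F_p).
Proof. by rewrite (Fp_p p_pr) addr0. Qed.

(** An invariant of the recursion: from [a] to [a + 1] every factorial gains one factor, and these
    are the factors of [recursion_Fp], since the subtracted p is 0 in the field. The last two
    hypotheses keep the subtractions exact. *)
Lemma selberg_step a : (0 < a)%N -> (a + k1.-1 * c < p)%N ->
  (forall i, (i < d)%N -> (p <= a + b1 + (i + k1.-1) * c)%N) ->
  (forall i, (i < k)%N -> (p + 2 * c <= a + b1 + b2 + (i + k1) * c)%N) ->
  selberg a * X a * Y a / Z a = selberg a.+1 * X a.+1 * Y a.+1 / Z a.+1.
Proof.
move=> a_gt0 ap hX hY.
apply/eqP; rewrite eqr_div ?Z_neq0 //; try lia; apply/eqP.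
have -> : Z a.+1 = (\prod_(n < k1) (a%:R + n%:R * c%:R)) * Z a.
  rewrite /Z -big_split; apply: eq_bigr => i _ /=.
  have -> : (a.+1 + i * c - 1 = (a + i * c - 1).+1)%N by lia.
  rewrite factFS; congr (_ * _); rewrite -natrM -natrD; congr (_%:R); lia.
have -> : X a.+1 = (\prod_(n < d) (a%:R + 1 + b1%:R + ((d + k)%:R - 1 + n%:R) * c%:R)) * X a.
  rewrite /X -big_split; apply: eq_bigr => i _ /=; have := hX i (ltn_ord i) => hi.
  have -> : (a.+1 + b1 + (i + k1.-1) * c - p = (a + b1 + (i + k1.-1) * c - p).+1)%N by lia.
  rewrite factFS; congr (_ * _); rewrite -FpN -natrD.
  have -> : ((a + b1 + (i + k1.-1) * c - p).+1 + p = a + 1 + b1 + (i + k1.-1) * c)%N by lia.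
  have <- : (k1.-1)%:R = k1%:R - 1 :> 'F_p by rewrite -[X in X%:R - 1](prednK k1_gt0) -natr1 addrK.
  by rewrite !(natrD, natrM); ring.
have -> : Y a.+1 = (\prod_(j < k) (a%:R + 1 + b1%:R + b2%:R +
    ((d + k)%:R - 2%:R + j%:R) * c%:R)) * Y a.
  rewrite /Y -big_split; apply: eq_bigr => i _ /=; have := hY i (ltn_ord i) => hi.
  have -> : (a.+1 + b1 + b2 + (i + k1) * c - (p + 2 * c) =
    (a + b1 + b2 + (i + k1) * c - (p + 2 * c)).+1)%N by lia.
  rewrite factFS; congr (_ * _); rewrite -FpN -natrD.
  apply: (addIr ((2 * c)%:R)); rewrite -natrD.
  have -> : ((a + b1 + b2 + (i + k1) * c - (p + 2 * c)).+1 + p + 2 * c =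
    a + 1 + b1 + b2 + (i + k1) * c)%N by lia.
  by rewrite !(natrD, natrM); ring.
have := recursion_Fp b1 b2 p_pr p_odd a_gt0 c_gt0 c_ltp k1_gt0.
rewrite weighted_shift -/(selberg a) -/(selberg a.+1) => [H|i]; last first.
  exact: tvar_neq0.
transitivity ((\prod_(n < k1) (a%:R + n%:R * c%:R) * selberg a) * X a * Y a * Z a).
  by ring.
by rewrite H; ring.
Qed.

(** The invariant is compared at [a] and at the starting point. The last two hypotheses bound the
    arguments of [X] and [Y] at the starting point; those at [a] are no larger, so [X a] and [Y a]
    are invertible. *)
Lemma selberg_value a : (0 < a)%N -> (a + k1.-1 * c <= p)%N -> (k1 * c < p)%N ->
  (forall i, (i < d)%N -> (p <= a + b1 + (i + k1.-1) * c)%N) ->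
  (forall i, (i < k)%N -> (p + 2 * c <= a + b1 + b2 + (i + k1) * c)%N) ->
  (forall i, (i < d)%N -> (b1 + i * c < p)%N) ->
  (forall i, (i < k)%N -> (b1 + b2 + i * c - c < p)%N) ->
  selberg a = dyson 'F_p c k1 * morris 'F_p c k (k1 * c) b2
   * (\prod_(i < d) (fa (b1 + i * c) / fa (a + b1 + (i + k1.-1) * c - p)))
   * (\prod_(i < k) (fa (b1 + b2 + i * c - c)
        / fa (a + b1 + b2 + (i + k1) * c - (p + 2 * c))))
   * (\prod_(i < k1) (fa (a + i * c - 1) / fa (p.-1 - i * c))).
Proof.
move=> a_gt0 ap k1c hX hY hX' hY'.
have step j : (a + j + k1.-1 * c <= p)%N ->
    selberg a * X a * Y a / Z a = selberg (a + j) * X (a + j) * Y (a + j) / Z (a + j).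
  elim: j => [|j IHj] jp; first by rewrite addn0.
  rewrite IHj; last by lia.
  rewrite addnS; apply: selberg_step; try lia.
    by move=> i /hX; lia.
  by move=> i /hY; lia.
have [j ajp] : exists j, (a + j + k1.-1 * c = p)%N by exists (p - (a + k1.-1 * c))%N; lia.
have := step j; rewrite ajp leqnn => /(_ isT).
have -> : selberg (a + j) = dyson 'F_p c k1 * morris 'F_p c k (k1 * c) b2.
  by apply: weighted_initial => //; lia.
have -> : X (a + j) = \prod_(i < d) fa (b1 + i * c).
  apply: eq_bigr => i _; congr fa; rewrite mulnDl; lia.
have -> : Y (a + j) = \prod_(i < k) fa (b1 + b2 + i * c - c).
  apply: eq_bigr => i _; congr fa; rewrite -[X in (i + X)%N](prednK k1_gt0); lia.
(* At the starting point [a + j = p - k1.-1 * c], so the factors appear in reverse order. *)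
have -> : Z (a + j) = \prod_(i < k1) fa (p.-1 - i * c).
  rewrite /Z [RHS](reindex_inj rev_ord_inj); apply: eq_bigr => i _; congr fa => /=.
  have -> : (k1 - i.+1 = k1.-1 - i)%N by lia.
  rewrite mulnBl; have : (i * c <= k1.-1 * c)%N; last by lia.
  by rewrite leq_mul2r; case: i => i /= ik; lia.
have XN : X a != 0.
  apply/prodf_neq0 => i _; apply: factF_neq0 => //.
  by have := hX' i (ltn_ord i); rewrite mulnDl; lia.
have YN : Y a != 0.
  apply/prodf_neq0 => i _; apply: factF_neq0 => //.
  by have := hY' i (ltn_ord i); rewrite -[X in (i + X)%N](prednK k1_gt0); lia.
move=> H; rewrite !prodf_div -/(X a) -/(Y a) -/(Z a).
have ZN := Z_neq0 ap a_gt0.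
have ZN' : \prod_(i < k1) fa (p.-1 - i * c) != 0.
  by apply/prodf_neq0 => i _; apply: factF_neq0 => //; have := prime_gt0 p_pr; lia.
move: H => /(canRL (divfK ZN)) /(canRL (mulfK YN)) /(canRL (mulfK XN)) ->.
by field; rewrite XN YN ZN'.
Qed.

End ClosedForm.

(** * Closed forms of the Morris and Dyson constant terms *)

Section MorrisDyson.
Variables (p c : nat).
Hypotheses (p_pr : prime p) (p_odd : odd p) (c_gt0 : (0 < c)%N).
Local Notation fa := (factF p).

(** The value a = p - e turns [(n-1) c <= e] into the range condition of the recursion. A Dyson term
    remains on the right; the induction of [dyson_value] removes it. *)
Lemma morris_value n e b : (0 < n)%N -> (n * c < p)%N -> (n.-1 * c <= e < p)%N ->
  (forall i, (i < n)%N -> (e <= b + (i + n.-1) * c)%N) ->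
  (forall i, (i < n)%N -> (b + i * c < p)%N) ->
  morris 'F_p c n e b = dyson 'F_p c n
   * (\prod_(i < n) (fa (b + i * c) / fa (b + (i + n.-1) * c - e)))
   * (\prod_(i < n) (fa (p - e + i * c - 1) / fa (p.-1 - i * c))).
Proof.
move=> n_gt0 nc /andP[en ep] h1 h2.
have cp : (c < p)%N by apply: leq_ltn_trans nc; rewrite leq_pmull.
have {1}-> : e = (p - (p - e))%N by lia.
rewrite -(@weighted_morris p n (p - e) b 0 c) //; last by lia.
have n0 : (0 < n + 0)%N by rewrite addn0.
have v := @selberg_value p n 0 b 0 c p_pr p_odd c_gt0 cp n0 (p - e).
rewrite /selberg in v; rewrite {}v ?addn0 //; try lia.
- rewrite morris0 mulr1 [X in _ * X * _]big_ord0 mulr1; congr (_ * _ * _).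
  apply: eq_bigr => i _; congr (_ / fa _).
  by have := h1 i (ltn_ord i); lia.
by move=> i /h1; lia.
Qed.

(** These are the factorials of [morris_value] at b = 2c, e = nc: numerator ((i+2)c)!, denominator
    ((i+1)c)!, so the product telescopes. *)
Lemma factF_prod_ratio n : ((n.+1) * c < p)%N -> (0 < n)%N ->
  \prod_(i < n) (fa (2 * c + i * c) / fa (2 * c + (i + n.-1) * c - n * c))
    = fa (n.+1 * c) / fa c.
Proof.
move=> nc n_gt0.
rewrite -(big_mkord xpredT (fun i => fa (2 * c + i * c) / fa (2 * c + (i + n.-1) * c - n * c))).
rewrite (@telescope_prodf_eq _ 0 n (fun i => fa (i.+1 * c))) ?mul1n // => i /andP[_ iltn].
  apply: factF_neq0 => //; apply: leq_ltn_trans nc.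
  by rewrite leq_mul2r; lia.
congr (fa _ / fa _); first by lia.
by rewrite -[X in (_ - X * c)%N](prednK n_gt0); lia.
Qed.

(** Read backwards, the numerators are (p-1-(i+1)c)!, so only (p-1-nc)! / (p-1)! survives; Wilson's
    identity evaluates it. *)
Lemma factF_prod_reflect n : (n * c < p)%N ->
  \prod_(i < n) (fa (p - n * c + i * c - 1) / fa (p.-1 - i * c))
    = (-1) ^+ (n * c) / fa (n * c).
Proof.
move=> nc; have p_gt1 := prime_gt1 p_pr.
have -> : (-1) ^+ (n * c) / fa (n * c) = fa (p.-1 - n * c) / fa p.-1.
  have := wilsonF p_pr nc; have := wilsonF p_pr (prime_gt0 p_pr).
  have fn0 : fa (n * c) != 0 by apply: factF_neq0.
  rewrite subn0 {2}/factF fact0 mulr1 expr1 => -> /(canRL (mulfK fn0)) ->.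
  by rewrite exprS mulN1r !mulNr invrN1 mulrN1 opprK.
rewrite prodf_div.
have -> : \prod_(i < n) fa (p - n * c + i * c - 1) = \prod_(i < n) fa (p.-1 - i.+1 * c).
  rewrite [LHS](reindex_inj rev_ord_inj); apply: eq_bigr => i _; congr fa => /=.
  have iltn := ltn_ord i.
  by rewrite mulnBl; have : (i.+1 * c <= n * c)%N; [rewrite leq_mul2r iltn orbT | lia].
case: n nc => [|n] nc; first by rewrite !big_ord0 mul0n subn0 divr1 divff // factF_neq0 //; lia.
rewrite big_ord_recr [X in _ / X]big_ord_recl /= mul0n subn0.
have N0 : \prod_(i < n) fa (p.-1 - i.+1 * c) != 0.
  by apply/prodf_neq0 => i _; apply: factF_neq0 => //; lia.
have P0 : fa p.-1 != 0 by apply: factF_neq0 => //; lia.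
under [X in _ / (_ * X)]eq_bigr => i _ do rewrite /bump /= add1n.
by field; rewrite N0 P0.
Qed.

(** Dyson's (nc)! / c!^n, left as a product so that [dyson_sign] can work factor by factor. *)
Lemma dyson_value n : (n * c < p)%N ->
  dyson 'F_p c n = \prod_(i < n) (fa (i.+1 * c) / (fa (i * c) * fa c)).
Proof.
elim: n => [|n IHn] nc; first by rewrite dyson0 big_ord0.
have nc' : (n * c < p)%N by lia.
have cp : (c < p)%N by apply: leq_ltn_trans nc; rewrite leq_pmull.
have fc : fa c != 0 by apply: factF_neq0.
rewrite dysonS big_ord_recr /= -IHn //.
case: (posnP n) => [->|n_gt0].
  by rewrite morris0 dyson0 !mul0n expr0 mul1n /factF fact0 !mul1r -/(fa c) divff.
rewrite morris_value //; first last.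
- move=> i iltn; apply: leq_ltn_trans nc.
  by rewrite -mulnDl leq_mul2r; lia.
- by move=> i iltn; rewrite -mulnDl leq_mul2r; lia.
- by rewrite nc' andbT leq_mul2r; lia.
rewrite factF_prod_ratio // factF_prod_reflect //.
have fn : fa (n * c) != 0 by apply: factF_neq0.
(* The same sign comes from [dysonS] and from the reflection of factorials, and squares to 1. *)
set e := (-1) ^+ (n * c).
transitivity (e * e * (dyson 'F_p c n * (fa (n.+1 * c) / (fa (n * c) * fa c)))).
  by field; rewrite fc fn.
by rewrite -expr2 sqrr_sign mul1r.
Qed.

(** By Wilson, (p-1-ic)! (ic)! is the sign of exponent ic + 1. Against the Vandermonde sign of
    exponent ic, each factor keeps a single -1; for n = k1 and n = k2 these make up the sign of the
    theorem. *)
Lemma dyson_sign n : (n * c < p)%N ->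
  (-1) ^+ (\sum_(i < n) i * c) * dyson 'F_p c n / \prod_(i < n) fa (p.-1 - i * c)
    = (-1) ^+ n * \prod_(i < n) (fa (i.+1 * c) / fa c).
Proof.
move=> nc; rewrite dyson_value // -prodrXr -[X in (-1) ^+ X]card_ord -prodr_const.
rewrite -prodfV -!big_split; apply: eq_bigr => i _ /=.
have ic : (i * c < p)%N by apply: leq_ltn_trans nc; rewrite leq_mul2r (ltnW (ltn_ord i)) orbT.
have := wilsonF p_pr ic.
have f1 : fa (i * c) != 0 by apply: factF_neq0.
have cp : (c < p)%N.
  by apply: leq_ltn_trans nc; rewrite leq_pmull ?(leq_ltn_trans _ (ltn_ord i)).

have f2 : fa c != 0 by apply: factF_neq0.
have f3 : fa (p.-1 - i * c) != 0.
  by apply: factF_neq0 => //; have := prime_gt0 p_pr; lia.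
have -> : (-1) ^+ (i * c) = - (-1) ^+ (i * c).+1 :> 'F_p by rewrite exprS; ring.
by move=> <-; field; rewrite f1 f2 f3.
Qed.

End MorrisDyson.

(** * The integrand of the theorem *)

(** Each unordered pair costs a sign of exponent c. The number of pairs is kept as the sum of the
    [i], which [dyson_sign] distributes over its factors. *)
Lemma vanderm_lt (R : comNzRingType) n c (y : 'I_n -> R) :
  \prod_(i < n) \prod_(i' < n | (i < i')%N) (y i - y i') ^+ (2 * c)
    = (-1) ^+ (\sum_(i < n) i * c) * vanderm c y.
Proof.
have -> : vanderm c y = (\prod_(i < n) \prod_(i' < n | (i < i')%N) (y i - y i') ^+ c)
    * \prod_(i < n) \prod_(i' < n | (i < i')%N) (y i' - y i) ^+ c.
  rewrite [X in _ * X](exchange_big_dep xpredT) //= -big_split; apply: eq_bigr => i _ /=.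
  rewrite (bigID (fun i' : 'I_n => (i < i')%N)) /=; congr (_ * _); apply: eq_bigl => j.
    by rewrite -val_eqE /=; case: ltngtP.
  by rewrite -val_eqE /=; case: ltngtP.
have -> : (-1) ^+ (\sum_(i < n) i * c) =
    \prod_(i < n) \prod_(i' < n | (i < i')%N) (-1) ^+ c :> R.
  rewrite -prodrXr (exchange_big_dep xpredT) //=; apply: eq_bigr => i _.
  rewrite (big_ord_narrow (ltnW (ltn_ord i))) prodr_const card_ord.
  by rewrite mulnC exprM.
rewrite mulrCA -!big_split; apply: eq_bigr => i _ /=; rewrite -!big_split.
apply: eq_bigr => j _ /=; rewrite -exprMn mulrC.
by rewrite mul2n -addnn exprD -exprMn mulN1r opprB exprMn.
Qed.

Lemma pull_signs (R : comNzRingType) (e1 e2 x1 x2 x3 x4 x5 x6 : R) :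
  x1 * x2 * x3 * x4 * (e1 * x5) * (e2 * x6) = e1 * e2 * (x1 * x2 * x3 * x4 * x5 * x6).
Proof. by ring. Qed.

Lemma PhiE (p k1 k2 a b1 b2 c : nat) t s :
  @Phi p k1 k2 a b1 b2 c t s
  = (-1) ^+ (\sum_(i < k1) i * c + \sum_(i < k2) i * c)
    * (\prod_i t i ^+ a * \prod_i (1 - t i) ^+ b1 * \prod_j (1 - s j) ^+ b2
       * (\prod_i \prod_j (s j - t i) ^+ (p - c)) * vanderm c t * vanderm c s).
Proof.
by rewrite /Phi !vanderm_lt exprD big_split; apply: pull_signs.
Qed.

(** The partner index always lies in range, so the default 0 of [onat] does not occur. *)
Lemma onat_shift (p k1 k2 d : nat) (f : 'I_(d + k2) -> FR p k1 k2) (j : 'I_k2) :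
  onat f (j + (d + k2 - k2)) = f (rshift d j).
Proof.
have jlt : (j + (d + k2 - k2) < d + k2)%N by rewrite addnK addnC ltn_add2l.
rewrite /onat insubT /=; congr f; apply: val_inj => /=.
by rewrite addnK addnC.
Qed.

Lemma integrand_cancel (K : fieldType) (A B C D e T X : K) :
  A != 0 -> B != 0 -> T != 0 ->
  e * D * (C * (A * (B * X))) / (T * A * B) = C * (e * (D * (T^-1 * X))).
Proof. by move=> A0 B0 T0; field; rewrite A0 B0 T0. Qed.

Section Symmetrization.
Variables (p d k a b1 b2 c : nat).
Hypotheses (p_pr : prime p) (a_gt0 : (0 < a)%N) (c_ltp : (c < p)%N).
Local Notation k1 := (d + k)%N.
Local Notation t := (@tvar p (d + k) k).
Local Notation s := (@svar p (d + k) k).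
Local Notation E := (fcoef (mono000 p (d + k) k)).
Local Notation W := (weighted t s a b1 b2 (p - c) c).

Lemma permute_weighted (sg : 'S_k1) (ta : 'S_k) : permute_vars p sg ta (W k1) =
  density t s a b1 b2 (p - c) c
    * ((\prod_i t i)^-1 * \prod_j (s (ta j) - t (sg (rshift d j)))^-1).
Proof.
rewrite /weighted rmorphM (S_density _ _ _ _ _ (@permute_tvar p _ _) (@permute_svar p _ _)).
rewrite rmorphM; congr (_ * (_ * _)).
  rewrite /invt rmorph_prod -prodfV [RHS](reindex_perm sg) /=.
  rewrite (eq_bigl xpredT) => [|i]; last exact: ltn_ord.
  by apply: eq_bigr => i _; rewrite fmorphV /= permute_tvar.
rewrite /invst rmorph_prod; apply: eq_bigr => j _.
by rewrite fmorphV rmorphB /= permute_tvar permute_svar.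
Qed.

(** Everything but the paired denominators is symmetric, so the sum over permutations moves from
    [W000] to the whole integrand, and each of its terms becomes an image of the same element. *)
Lemma integrandE : integrand000 p k1 k a b1 b2 c =
  ((k1`!)%:R * (k`!)%:R)^-1 * ((-1) ^+ (\sum_(i < k1) i * c + \sum_(i < k) i * c)
  * \sum_(sg : 'S_k1) \sum_(ta : 'S_k) permute_vars p sg ta (W k1)).
Proof.
pose V (sg : 'S_k1) (ta : 'S_k) := \prod_j (s (ta j) - t (sg (rshift d j)))^-1.
have -> : \sum_(sg : 'S_k1) \sum_(ta : 'S_k) permute_vars p sg ta (W k1) =
    density t s a b1 b2 (p - c) c * ((\prod_i t i)^-1 * \sum_sg \sum_ta V sg ta).
  rewrite !mulr_sumr; apply: eq_bigr => sg _; rewrite !mulr_sumr.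
  by apply: eq_bigr => ta _; apply: permute_weighted.
rewrite /integrand000 /W000 PhiE -/(density t s a b1 b2 (p - c) c) big_split /=.
have -> : \sum_(sg : 'S_k1) \sum_(ta : 'S_k)
      Wterm (fun i => t (sg i)) (fun j => s (ta j)) =
    (\prod_i (1 - t i)) * ((\prod_j (1 - s j)) * \sum_sg \sum_ta V sg ta).
  rewrite !mulr_sumr; apply: eq_bigr => sg _; rewrite !mulr_sumr.
  apply: eq_bigr => ta _; rewrite /Wterm /V; congr (_ * _).
    by rewrite [RHS](reindex_perm sg).
  rewrite [X in _ = X * _](reindex_perm ta) /= -big_split; apply: eq_bigr => j _ /=.
  by rewrite (onat_shift (fun i => t (sg i))).
apply: integrand_cancel; apply/prodf_neq0 => i _.
- exact: one_sub_tvar_neq0.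
- exact: one_sub_svar_neq0.
- exact: tvar_neq0.
Qed.

Lemma is_mpoly_weighted : is_mpoly (W k1).
Proof. by rewrite weighted_mpoly //; eexists. Qed.

Lemma fcoefZ z (x : FR p k1 k) : is_mpoly x -> E ((z%:MP)%:F * x) = z * E x.
Proof. by move=> [P <-]; rewrite -tofracM !fcoef_tofrac mcoeffCM. Qed.

(** [k1 < p] makes k1! k2! invertible mod p, so the average can be taken; all its terms have the
    same coefficient. *)
Lemma integrand_coef : (k1 < p)%N ->
  is_mpoly (integrand000 p k1 k a b1 b2 c) /\
  E (integrand000 p k1 k a b1 b2 c) =
    (-1) ^+ (\sum_(i < k1) i * c + \sum_(i < k) i * c) * E (W k1).
Proof.
move=> k1p; set q := (\sum_(i < k1) i * c + \sum_(i < k) i * c)%N.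
have kp : (k < p)%N by apply: leq_ltn_trans k1p; rewrite leq_addl.
set u : 'F_p := (k1`!)%:R * (k`!)%:R.
have u0 : u != 0 by rewrite mulf_neq0 // factF_neq0.
have uF : ((k1`!)%:R * (k`!)%:R)^-1 = (u^-1)%:MP%:F :> FR p k1 k.
  apply: (mulfI (x := u%:MP%:F)).
    by rewrite tofrac_eq0 mpolyC_eq0.
  rewrite -[RHS]tofracM -mpolyCM divff // mpolyC1 tofrac1.
  have -> : u%:MP%:F = (k1`!)%:R * (k`!)%:R :> FR p k1 k.
    by rewrite /u mpolyCM tofracM !mpolyC_nat !rmorph_nat.
  rewrite divff //.
  have <- : u%:MP%:F = (k1`!)%:R * (k`!)%:R :> FR p k1 k.
    by rewrite /u mpolyCM tofracM !mpolyC_nat !rmorph_nat.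
  by rewrite tofrac_eq0 mpolyC_eq0.
have eF : (-1) ^+ q = ((-1) ^+ q)%:MP%:F :> FR p k1 k.
  by rewrite !rmorphXn !rmorphN !rmorph1.
have Iw sg ta : is_mpoly (permute_vars p sg ta (W k1)).
  exact/is_mpoly_permute/is_mpoly_weighted.
have IB := @is_mpolyB 'F_p (k1 + k); have I1 := @is_mpoly1 'F_p (k1 + k).
have Iws sg : is_mpoly (\sum_ta permute_vars p sg ta (W k1)) by apply: (closed_sum I1 IB).
have Isum : is_mpoly (\sum_sg \sum_ta permute_vars p sg ta (W k1)) by apply: (closed_sum I1 IB).
have Ic z x : is_mpoly x -> is_mpoly ((z%:MP)%:F * x :> FR p k1 k).
  by move=> Ix; apply: is_mpolyM => //; exists z%:MP.
have -> : integrand000 p k1 k a b1 b2 c = (u^-1)%:MP%:F *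
    (((-1) ^+ q)%:MP%:F * \sum_sg \sum_ta permute_vars p sg ta (W k1)).
  by rewrite integrandE uF; congr (_ * (_ * _)).
split; first exact: (Ic _ _ (Ic _ _ Isum)).
rewrite !fcoefZ //; last exact: Ic.
have Esum : E (\sum_sg \sum_ta permute_vars p sg ta (W k1)) = u * E (W k1).
  rewrite (functional_sum I1 IB (@fcoefB _ _ _)) //.
  rewrite (eq_bigr (fun=> (k`!)%:R * E (W k1))) => [|sg _].
    by rewrite sumr_const card_Sn -[LHS]mulr_natl mulrA.
  rewrite (functional_sum I1 IB (@fcoefB _ _ _)) //.
  rewrite (eq_bigr (fun=> E (W k1))) => [|ta _].
    by rewrite sumr_const card_Sn mulr_natl.
  exact/fcoef_permute/is_mpoly_weighted.
by rewrite Esum [LHS]mulrCA mulKf.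
Qed.

End Symmetrization.

Lemma fctFE (p n : nat) (z : int) : z = n%:Z -> fctF p z = factF p n.
Proof. by move=> ->. Qed.

Lemma combine_signs (K : fieldType) (e1 e2 D1 D2 W1 W2 s1 s2 G1 G2 A NB X Y NZ : K) :
  e1 * D1 / W1 = s1 * G1 -> e2 * D2 / W2 = s2 * G2 ->
  e1 * e2 * (D1 * (D2 * A * (NB / W2)) * X * Y * (NZ / W1))
    = s1 * s2 * X * (A * Y) * NZ * NB * G1 * G2.
Proof.
move=> h1 h2; transitivity ((e1 * D1 / W1) * (e2 * D2 / W2) * A * NB * X * Y * NZ).
  by ring.
by rewrite h1 h2; ring.
Qed.

Theorem theorem5p8 (p k1 k2 a b1 b2 c : nat) :
  prime p -> odd p ->
  (0 < k2)%N -> (k2 < k1)%N ->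
  (0 < a)%N -> (0 < b1)%N -> (0 < b2)%N -> (0 < c)%N ->
  (a + (k1 - 1) * c < p)%N ->
  (* all factorials on the right-hand side are of integers in [0, p) *)
  (forall i : nat, (1 <= i <= k1 - k2)%N ->
     fct_ok p (b1%:Z + (i%:Z - 1) * c%:Z)
     && fct_ok p (a%:Z + b1%:Z + (i%:Z + k1%:Z - 2) * c%:Z - p%:Z)) ->
  (forall i : nat, (1 <= i <= k2)%N ->
     [&& fct_ok p (b2%:Z + (i%:Z - 1) * c%:Z),
         fct_ok p (b2%:Z + (i%:Z + k2%:Z - k1%:Z - 2) * c%:Z),
         fct_ok p (b1%:Z + b2%:Z + (i%:Z - 2) * c%:Z),
         fct_ok p (a%:Z + b1%:Z + b2%:Z + (i%:Z + k1%:Z - 3) * c%:Z - p%:Z) &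
         fct_ok p (p%:Z + (i%:Z - k1%:Z - 1) * c%:Z - 1)]) ->
  (forall i : nat, (1 <= i <= k1)%N ->
     fct_ok p (a%:Z + (i%:Z - 1) * c%:Z - 1) && fct_ok p (i%:Z * c%:Z)) ->
  fct_ok p c%:Z ->
  Fp_integral_is (integrand000 p k1 k2 a b1 b2 c)
    ((-1) ^+ (k1 + k2)
     * (\prod_(1 <= i < (k1 - k2).+1)
          (fctF p (b1%:Z + (i%:Z - 1) * c%:Z)
           / fctF p (a%:Z + b1%:Z + (i%:Z + k1%:Z - 2) * c%:Z - p%:Z)))
     * (\prod_(1 <= i < k2.+1)
          (fctF p (b2%:Z + (i%:Z - 1) * c%:Z)
           / fctF p (b2%:Z + (i%:Z + k2%:Z - k1%:Z - 2) * c%:Z)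
           * (fctF p (b1%:Z + b2%:Z + (i%:Z - 2) * c%:Z)
              / fctF p (a%:Z + b1%:Z + b2%:Z + (i%:Z + k1%:Z - 3) * c%:Z - p%:Z))))
     * (\prod_(1 <= i < k1.+1) fctF p (a%:Z + (i%:Z - 1) * c%:Z - 1))
     * (\prod_(1 <= i < k2.+1) fctF p (p%:Z + (i%:Z - k1%:Z - 1) * c%:Z - 1))
     * (\prod_(1 <= i < k1.+1) (fctF p (i%:Z * c%:Z) / fctF p c%:Z))
     * (\prod_(1 <= i < k2.+1) (fctF p (i%:Z * c%:Z) / fctF p c%:Z))).
Proof.
move=> p_pr p_odd k2_gt0 k2k1 a_gt0 b1_gt0 b2_gt0 c_gt0 ap h1 h2 _ _.
have [d k1E] : exists d, k1 = (d + k2)%N by exists (k1 - k2)%N; rewrite subnK // ltnW.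
subst k1; rewrite /fct_ok in h1 h2.
(* From the nonnegativity of [p + (i - k1 - 1) * c - 1] at [i = 1]. *)
have k1c : ((d + k2) * c < p)%N by have := h2 1%N; lia.
(* [lia] treats the products with [c] as atoms, so the linear relations among them are supplied
   here. *)
have k1_le : (d + k2 <= (d + k2) * c)%N by rewrite leq_pmulr.
have c_le : (c <= (d + k2) * c)%N by rewrite leq_pmull //; lia.
have k2c : (k2 * c <= (d + k2) * c)%N by rewrite leq_mul2r leq_addl orbT.
have k2c' : (k2.-1 * c <= (d + k2) * c)%N by apply: leq_trans k2c; rewrite leq_mul2r leq_pred orbT.
have cp : (c < p)%N by lia.
have c_le2 : (c <= k2 * c)%N by rewrite leq_pmull.
have k2_pred : (k2.-1 * c = k2 * c - c)%N by rewrite -subn1 mulnBl mul1n.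
have k1_pred : ((d + k2).-1 * c = (d + k2) * c - c)%N by rewrite -subn1 mulnBl mul1n.
have k1_gt0 : (0 < d + k2)%N by lia.
have [[P PE] PF] := @integrand_coef p d k2 a b1 b2 c p_pr a_gt0 cp (leq_ltn_trans k1_le k1c).
exists P; split=> //; rewrite -fcoef_tofrac PE PF -/(selberg p d k2 b1 b2 c a).
rewrite selberg_value //; first last.
- by move=> i ik; have := h2 i.+1; lia.
- by move=> i ik; have := h1 i.+1; lia.
- by move=> i ik; have := h2 i.+1; lia.
- by move=> i ik; have := h1 i.+1; lia.
- by rewrite -subn1 ltnW.
rewrite morris_value //; first last.
- by move=> i ik; have := h2 i.+1; lia.
- by move=> i ik; have := h2 i.+1; rewrite [((i + _) * c)%N]mulnDl k2_pred; lia.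
- by rewrite k2c' k1c.
- exact: leq_ltn_trans k2c k1c.
set X := \prod_(1 <= i < _.+1) _; set AY := \prod_(1 <= i < k2.+1) _.
set NZ := \prod_(1 <= i < (d + k2).+1) fctF _ _.
set NB := \prod_(1 <= i < k2.+1) fctF _ _.
set G1 := \prod_(1 <= i < (d + k2).+1) _; set G2 := \prod_(1 <= i < k2.+1) _.
have G1E : G1 = \prod_(i < d + k2) (factF p (i.+1 * c) / factF p c).
  rewrite /G1 big_add1 big_mkord; apply: eq_bigr => -[i ilt] _ /=.
  by congr (_ / _); apply: fctFE; lia.
have G2E : G2 = \prod_(i < k2) (factF p (i.+1 * c) / factF p c).
  rewrite /G2 big_add1 big_mkord; apply: eq_bigr => -[i ilt] _ /=.
  by congr (_ / _); apply: fctFE; lia.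
have XE : X = \prod_(i < d) (factF p (b1 + i * c)
    / factF p (a + b1 + (i + (d + k2).-1) * c - p)).
  rewrite /X addnK big_add1 big_mkord; apply: eq_bigr => -[i ilt] _ /=.
  have /h1 hi : (1 <= i.+1 <= d + k2 - k2)%N by rewrite addnK ilt.
  congr (_ / _); apply: fctFE; rewrite ?[((i + _) * c)%N]mulnDl
    ?k1_pred ?k2_pred; lia.
have AYE : AY = \prod_(i < k2) (factF p (b2 + i * c)
      / factF p (b2 + (i + k2.-1) * c - (d + k2) * c))
    * \prod_(i < k2) (factF p (b1 + b2 + i * c - c)
      / factF p (a + b1 + b2 + (i + (d + k2)) * c - (p + 2 * c))).
  rewrite /AY big_add1 big_mkord -big_split; apply: eq_bigr => -[i ilt] _ /=.
  have /h2 hi : (1 <= i.+1 <= k2)%N by rewrite ilt.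
  congr (_ / _ * (_ / _)); apply: fctFE; rewrite ?[((i + _) * c)%N]mulnDl
    ?k1_pred ?k2_pred; lia.
have NZE : NZ = \prod_(i < d + k2) factF p (a + i * c - 1).
  rewrite /NZ big_add1 big_mkord; apply: eq_bigr => -[i ilt] _ /=.
  by apply: fctFE; rewrite ?[((i + _) * c)%N]mulnDl; lia.
have NBE : NB = \prod_(i < k2) factF p (p - (d + k2) * c + i * c - 1).
  rewrite /NB big_add1 big_mkord; apply: eq_bigr => -[i ilt] _ /=.
  by apply: fctFE; rewrite ?[((i + _) * c)%N]mulnDl; lia.
rewrite G1E G2E XE AYE NZE NBE !prodf_div.
have s1 := dyson_sign p_pr p_odd c_gt0 k1c.
have s2 := dyson_sign p_pr p_odd c_gt0 (leq_ltn_trans k2c k1c).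
rewrite !prodf_div in s1 s2.
rewrite exprD [X in _ = X * _ * _ * _ * _ * _ * _]exprD.
exact: combine_signs s1 s2.
Qed.
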